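(* Let $\alpha:M\to M$ be a normal unit-preserving $*$-endomorphism of a von Neumann algebra $M$. Then $\alpha$ has an asymptotic lift, and any two asymptotic lifts of $\alpha$ are isomorphic.
   Context: A lifting of $\alpha:M\to M$ is a triple $(N,\beta,E)$ where $\beta$ is a $*$-automorphism of a von Neumann algebra $N$ and $E:N\to M$ is a unit-preserving normal $*$-homomorphism satisfying $E\circ\beta=\alpha\circ E$. It is nondegenerate if, for $x\in N$, $E(\beta^n(x))=0$ for all $n\in\mathbb Z$ implies $x=0$. Let $M_\infty=\bigcap_{n=1}^\infty\alpha^n(M)$ be the tail algebra of $\alpha$. An asymptotic lift of $\alpha$ is a nondegenerate lifting $(N,\beta,E)$ satisfying the following equivalent conditions: (i) $\lim_{n\to\infty}\|\rho\circ\alpha^n\|=\|\rho\circ E\|$ for every normal linear functional $\rho\in M_*$; (ii) $E(N)=M_\infty$. Two liftings $(N_k,\beta_k,E_k)$, $k=1,2$, of $\alpha$ are isomorphic if there is an isomorphism of von Neumann algebras $\gamma:N_1\to N_2$ with $\gamma\circ\beta_1=\beta_2\circ\gamma$ and $E_2\circ\gamma=E_1$. *)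

(* Defs.v *)
From HB Require Import structures.
From mathcomp Require Import all_boot all_order all_algebra.
From mathcomp Require Import sesquilinear.
From mathcomp Require Import complex.
From mathcomp Require Import all_classical all_reals all_analysis.
Set Implicit Arguments.
Unset Strict Implicit.
Unset Printing Implicit Defensive.
Import Order.TTheory GRing.Theory Num.Theory.
Import numFieldNormedType.Exports.
Local Open Scope classical_set_scope.
Local Open Scope ring_scope.
Local Open Scope complex_scope.

(* The inner product [dot] is linear in its first argument. Norms on spaces
   over [R[i]] take their values in [R[i]]. *)
HB.mixin Record CompleteNormedModule_isHilbert (R : realType) H
    of CompleteNormedModule R[i] H := {
  dot : {dot H for (@Num.conj R[i])} ;
  dotE : forall x : H, dot x x = `|x| ^+ 2
}.

#[short(type="hilbertType")]
HB.structure Definition Hilbert (R : realType) :=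
  {H of CompleteNormedModule R[i] H & CompleteNormedModule_isHilbert R H}.

Section Operators.
Variables (R : realType) (H : hilbertType R).
Implicit Types (S : set (H -> H)) (f g : H -> H).

(* For linear maps between normed spaces, bounded means continuous. *)
Definition bounded_operator : set (H -> H) :=
  [set f | linear f /\ continuous f].

Definition adjoint f g := forall x y : H, dot (f x) y = dot x (g y).

Definition commutant S : set (H -> H) :=
  [set f | bounded_operator f /\ forall g, S g -> f \o g = g \o f].

End Operators.

(* Concrete von Neumann algebras: self-adjoint sets of bounded operators on a
   Hilbert space that equal their double commutant. *)
Record vnAlgebra (R : realType) := VnAlgebra {
  vn_space : hilbertType R ;
  vn_set : set (vn_space -> vn_space) ;
  vn_adjoint : forall f, vn_set f -> exists2 g, vn_set g & adjoint f g ;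
  vn_bicommutant : commutant (commutant vn_set) = vn_set
}.

Arguments vn_space {R} _.
Arguments vn_set {R} _.

Section VnElements.
Variables (R : realType) (M : vnAlgebra R).
Local Notation H := (vn_space M).

Definition vn_pred : {pred (H -> H)} := fun f => f \in vn_set M.

Lemma vn_predP (f : H -> H) :
  reflect (commutant (commutant (vn_set M)) f) (f \in vn_pred).
Proof. by rewrite vn_bicommutant unfold_in; apply: asboolP. Qed.

Lemma vn_submod_closed : submod_closed vn_pred.
Proof.
split.
  apply/vn_predP; split; first split.
  - by move=> a x y; rewrite /= scaler0 addr0.
  - exact: cst_continuous.
  move=> g [[lg _] _]; apply/funext => x /=.
  by have := lg (-1) 0 0; rewrite scaler0 addr0 scaleN1r addNr => ->.
move=> a f g /vn_predP[[lf cf] hf] /vn_predP[[lg cg] hg].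
apply/vn_predP; split; first split.
- move=> b x y; rewrite /= !fctE lf lg !scalerDr !scalerA [b * a]mulrC.
  by rewrite addrACA.
- by move=> x; apply: cvgD; [apply: cvgZr; exact: cf | exact: cg].
move=> h Ch; have [[lh _] _] := Ch.
apply/funext => x; rewrite /= !fctE lh.
by rewrite -[f (h x)]/((f \o h) x) -[g (h x)]/((g \o h) x) hf// hg.
Qed.

HB.instance Definition _ :=
  GRing.isSubmodClosed.Build R[i] (H -> H) vn_pred
    (GRing.submod_closed_semi vn_submod_closed).

Definition vn_elt := {f : H -> H | f \in vn_pred}.

HB.instance Definition _ := SubType.on vn_elt.
HB.instance Definition _ := Choice.on vn_elt.
HB.instance Definition _ :=
  [SubChoice_isSubLmodule of vn_elt by <:].

Lemma vn_one_subproof : (id : H -> H) \in vn_pred.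
Proof.
apply/vn_predP; split; last by [].
by split; [move=> a x y | move=> x; exact: cvg_id].
Qed.

Lemma vn_mul_subproof (x y : vn_elt) : val x \o val y \in vn_pred.
Proof.
have /vn_predP[[lx cx] hx] := valP x; have /vn_predP[[ly cy] hy] := valP y.
apply/vn_predP; split; first split.
- by move=> a u v; rewrite /= ly lx.
- by move=> u; apply: continuous_comp; [exact: cy | exact: cx].
move=> h Ch; apply/funext => u /=.
have /= -> := congr1 (fun k : H -> H => val x (k u)) (hy h Ch).
by have /= -> := congr1 (fun k : H -> H => k (val y u)) (hx h Ch).
Qed.

Definition vn_one : vn_elt :=
  exist (fun f : H -> H => f \in vn_pred) id vn_one_subproof.
Definition vn_mul (x y : vn_elt) : vn_elt :=
  exist (fun f : H -> H => f \in vn_pred) _ (vn_mul_subproof x y).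

Lemma vn_mulA : associative vn_mul.
Proof. by move=> x y z; apply: val_inj. Qed.

Lemma vn_mul1x : left_id vn_one vn_mul.
Proof. by move=> x; apply: val_inj. Qed.

Lemma vn_mulx1 : right_id vn_one vn_mul.
Proof. by move=> x; apply: val_inj. Qed.

Lemma vn_mulDl : left_distributive vn_mul +%R.
Proof. by move=> x y z; apply: val_inj. Qed.

Lemma vn_mulDr : right_distributive vn_mul +%R.
Proof.
move=> x y z; apply: val_inj; apply/funext => u /=.
have /vn_predP[[lx _] _] := valP x.
by have := lx 1 (val y u) (val z u); rewrite !scale1r.
Qed.

HB.instance Definition _ := GRing.Zmodule_isPzRing.Build vn_elt
  vn_mulA vn_mul1x vn_mulx1 vn_mulDl vn_mulDr.

Lemma vn_star_subproof (x : vn_elt) :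
  exists y : vn_elt, adjoint (val x) (val y).
Proof.
have [g gM xg] := vn_adjoint (set_mem (valP x : val x \in vn_set M)).
by exists (exist (fun f : H -> H => f \in vn_pred) g (mem_set gM)).
Qed.

Definition star (x : vn_elt) : vn_elt := projT1 (cid (vn_star_subproof x)).

Lemma starP (x : vn_elt) : adjoint (val x) (val (star x)).
Proof. exact: projT2 (cid (vn_star_subproof x)). Qed.

(* The closed unit ball for the operator norm. *)
Definition unit_ball : set vn_elt :=
  [set x | forall u : H, `|val x u| <= `|u|].

(* The ultraweak topology is generated by the functionals
   x |-> \sum_n <x (u n), v n>, with u and v square-summable. *)
Definition square_summable : set (nat -> H) :=
  [set u | cvgn (series (fun n => `|u n| ^+ 2 : R[i]^o))].

Definition vector_functional (x : vn_elt) (p : square_summable * square_summable)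
    : R[i]^o :=
  limn (series (fun n => dot (val x (set_val p.1 n)) (set_val p.2 n) : R[i]^o)).

Definition ultraweak := initial_topology
  (vector_functional :
     vn_elt -> {ptws (square_summable * square_summable)%type -> R[i]^o}).
HB.instance Definition _ := Topological.on ultraweak.

Definition normal_functional (rho : vn_elt -> R[i]^o) :=
  linear rho /\ continuous (rho : ultraweak -> R[i]^o).

Definition functional_norm (rho : vn_elt -> R[i]^o) : \bar R :=
  ereal_sup [set (complex.Re `|rho x|)%:E | x in unit_ball].

End VnElements.

Coercion vn_elt : vnAlgebra >-> Sortclass.
Arguments ultraweak {R} M.

Section Liftings.
Variable R : realType.
Implicit Types M N : vnAlgebra R.

Definition star_hom M N (f : M -> N) :=
  [/\ linear f, monoid_morphism f & forall x, f (star x) = star (f x)].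

Definition normal M N (f : M -> N) :=
  continuous (f : ultraweak M -> ultraweak N).

Record lifting M (alpha : M -> M) := Lifting {
  lift_alg : vnAlgebra R ;
  lift_aut : lift_alg -> lift_alg ;
  lift_autV : lift_alg -> lift_alg ;
  lift_map : lift_alg -> M ;
  lift_aut_hom : star_hom lift_aut ;
  lift_autK : cancel lift_aut lift_autV ;
  lift_autVK : cancel lift_autV lift_aut ;
  lift_map_hom : star_hom lift_map ;
  lift_map_normal : normal lift_map ;
  lift_comm : lift_map \o lift_aut = alpha \o lift_map
}.

Definition lift_aut_iter M (alpha : M -> M) (L : lifting alpha) (n : int) :
    lift_alg L -> lift_alg L :=
  match n with
  | Posz k => iter k (@lift_aut _ _ L)
  | Negz k => iter k.+1 (@lift_autV _ _ L)
  end.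

Definition nondegenerate_lifting M (alpha : M -> M) (L : lifting alpha) :=
  forall x : lift_alg L,
    (forall n : int, lift_map (lift_aut_iter n x) = 0) -> x = 0.

Definition asymptotic_lift M (alpha : M -> M) (L : lifting alpha) :=
  nondegenerate_lifting L /\
  forall rho : M -> R[i]^o, normal_functional rho ->
    (fun n => functional_norm (rho \o iter n alpha)) @ \oo -->
      functional_norm (rho \o @lift_map _ _ L).

(* *-isomorphisms of von Neumann algebras are automatically normal. *)
Definition isomorphic_liftings M (alpha : M -> M) (L1 L2 : lifting alpha) :=
  exists gamma : lift_alg L1 -> lift_alg L2,
    [/\ star_hom gamma, bijective gamma,
        gamma \o @lift_aut _ _ L1 = @lift_aut _ _ L2 \o gamma &
        @lift_map _ _ L2 \o gamma = @lift_map _ _ L1].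

End Liftings.

(* Main.v *)
Require Import Defs.
From HB Require Import structures.
From mathcomp Require Import all_boot all_order all_algebra.
From mathcomp Require Import sesquilinear complex.
From mathcomp Require Import all_classical all_reals all_analysis.
From mathcomp Require Import ring lra.

(** Write [E] for the map of a lifting into [M] and [beta] for its automorphism.

Existence.  The bounded sequences [x] in [M] with [alpha (x k.+1) = x k] act
diagonally on the direct sum [l2 H] of countably many copies of the space of
[M].  These operators form a unital self-adjoint algebra.  An operator in its
bicommutant is diagonal with entries in [M], and by the density theorem
([bicommutant_density]) it is an ultraweak limit of elements of the algebra;
since [alpha] is normal, the relation between consecutive entries survives the
limit, so the algebra is a von Neumann algebra ([inverse_limit]).  Applying
[alpha] to all entries of a sequence amounts to inserting [alpha (x 0)] in front
of it, which is inverse to the left shift, and [E] is the entry of index 0.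
The norms of [rho \o alpha^n] decrease and bound that of [rho \o E] from above,
because [x 0 = alpha^n (x n)].  Conversely, if contractions [a n] satisfy
[c < |rho (alpha^n (a n))|], then the limits [y k] of [alpha^(n - k) (a n)] along
a free ultrafilter form a backward orbit with [c <= |rho (y 0)|]
([ball_orbit_exists]).

Uniqueness.  For two asymptotic lifts the norms of [rho \o E1] and [rho \o E2]
agree for every normal [rho].  The images of the two unit balls are convex and
weakly compact, so a separation argument in [l2 H] shows that they coincide
([asymptotic_ball_image]).  Given [y] in the unit ball of the first algebra,
choose [z n] in the unit ball of the second with [E2 (z n) = E1 (beta1^-n y)]
and put [w n = beta2^n (z n)].  For [m >= n] the elements [w m] and [w n] differ
by an element of the kernel of [E2 \o beta2^-n].  The powers of [beta2] carry no
continuity assumption, so a limit of the [w n] is controlled algebraically: the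
kernel of a normal homomorphism is a left ideal with a right unit
([kernel_right_unit]), which yields [q n] such that [w m * (1 - q n)] does not
depend on [m >= n].  A weak limit [w] of the sequence then satisfies
[E2 (beta2^-n w) = E1 (beta1^-n y)] for all [n] ([transfer_exists]), and by
nondegeneracy [y |-> w] is an isomorphism of liftings.

Two facts are used throughout: a bounded family of operators has a weak limit
along every ultrafilter ([op_le_ultralimit]), where weak and ultraweak limits
agree ([wcvg_ultraweak]); and a unital star-homomorphism is contractive
([star_hom_contractive]). *)

Set Implicit Arguments.
Unset Strict Implicit.
Unset Printing Implicit Defensive.
Import Order.TTheory GRing.Theory Num.Theory.
Import numFieldNormedType.Exports.
Local Open Scope classical_set_scope.
Local Open Scope ring_scope.
Local Open Scope complex_scope.

(** * Real-valued norms and inner products *)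

Section RealNorm.
Variable (R : realType).

Section Norm.
Variable (V : normedModType R[i]).
Implicit Types (x y z : V).

(** The norm of a space over [R[i]] takes its values in [R[i]]; all estimates
below use this real number instead. *)
Definition nrm x : R := complex.Re `|x|.

Lemma nrmE x : `|x| = (nrm x)%:C.
Proof. by rewrite /nrm RRe_real// realE normr_ge0. Qed.

Lemma nrm_ge0 x : 0 <= nrm x.
Proof. by rewrite -ler0c -nrmE. Qed.

Lemma nrm0 : nrm (0 : V) = 0.
Proof. by rewrite /nrm normr0. Qed.

Lemma nrm_eq0 x : nrm x = 0 -> x = 0.
Proof. by move=> h; apply: normr0_eq0; rewrite nrmE h. Qed.

Lemma nrm_gt0 x : x != 0 -> 0 < nrm x.
Proof. by move=> x0; rewrite -ltcR -nrmE normr_gt0. Qed.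

Lemma nrmN x : nrm (- x) = nrm x.
Proof. by rewrite /nrm normrN. Qed.

Lemma nrm_subC x y : nrm (x - y) = nrm (y - x).
Proof. by rewrite -nrmN opprB. Qed.

Lemma ler_nrmD x y : nrm (x + y) <= nrm x + nrm y.
Proof. by rewrite -lecR rmorphD/= -!nrmE ler_normD. Qed.

Lemma ler_nrm_dist y x z : nrm (x - z) <= nrm (x - y) + nrm (y - z).
Proof. by rewrite -[x - z](subrKA y) ler_nrmD. Qed.

Lemma ler_nrmB x y : `|nrm x - nrm y| <= nrm (x - y).
Proof.
have := ler_nrmD (x - y) y; rewrite subrK => h1.
have := ler_nrmD (y - x) x; rewrite subrK nrm_subC => h2.
by rewrite ler_norml; apply/andP; split; lra.
Qed.

Lemma nrm_cvgP (F : set_system V) {FF : Filter F} x :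
  F --> x <-> forall e : R, 0 < e -> \forall y \near F, nrm (x - y) < e.
Proof.
split=> [/cvgrPdist_lt h e e0|h].
  have /h : (0 : R[i]) < e%:C by rewrite ltcR.
  by apply: filterS => y; rewrite nrmE ltcR.
apply/cvgrPdist_lt => e e0.
have eR : e = (complex.Re e)%:C by rewrite RRe_real// realE ltW.
have /h : 0 < complex.Re e by rewrite -ltcR -eR.
by apply: filterS => y; rewrite nrmE eR ltcR.
Qed.

End Norm.

Lemma nrmZ (V : normedModType R[i]) (a : R[i]) (x : V) :
  nrm (a *: x) = complex.Re `|a| * nrm x.
Proof.
apply: (@complexI R); rewrite rmorphM/= -nrmE normrZ nrmE; congr (_ * _).
Qed.

Lemma nrmZr (V : normedModType R[i]) (a : R) (x : V) :
  nrm (a%:C *: x) = `|a| * nrm x.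
Proof. by rewrite nrmZ normc_def /= expr0n addr0 sqrtr_sqr. Qed.

Lemma nrm_Re (z : R[i]^o) : `|complex.Re z| <= nrm z.
Proof. by rewrite -lecR -nrmE; exact: normc_ge_Re. Qed.

(** Multiplication by the imaginary unit reduces statements on imaginary parts
to statements on real parts. *)
Lemma nrmMi (z : R[i]^o) : nrm ('i%C * z : R[i]^o) = nrm z.
Proof.
rewrite (_ : 'i%C * z = 'i%C *: z)//.
by rewrite nrmZ normc_def /= expr0n expr1n add0r sqrtr1 mul1r.
Qed.

Lemma nrm_Im (z : R[i]^o) : `|complex.Im z| <= nrm z.
Proof.
rewrite -nrmMi; have -> : complex.Im z = - complex.Re ('i%C * z).
  by case: z => a b /=; rewrite !mul0r !mul1r sub0r opprK.
by rewrite normrN nrm_Re.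
Qed.

Lemma nrm_ReIm (z : R[i]^o) : nrm z <= `|complex.Re z| + `|complex.Im z|.
Proof.
rewrite [X in nrm X]complexE; apply: (le_trans (ler_nrmD _ _)).
rewrite nrmMi lerD//.
  by rewrite -(mulr1 (complex.Re z)%:C) -/(_ *: (1 : R[i]^o)) nrmZr /nrm normr1 mulr1.
by rewrite -(mulr1 (complex.Im z)%:C) -/(_ *: (1 : R[i]^o)) nrmZr /nrm normr1 mulr1.
Qed.

Lemma cvg_complexP (F : set_system R[i]^o) {FF : Filter F} (z : R[i]^o) :
  F --> z <-> (complex.Re w @[w --> F] --> complex.Re z) /\
              (complex.Im w @[w --> F] --> complex.Im z).
Proof.
split=> [/nrm_cvgP h|[/cvgrPdist_lt hr /cvgrPdist_lt hi]].
  split; apply/cvgrPdist_lt => e /h; apply: filterS => y; apply: le_lt_trans.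
    by have := nrm_Re (z - y); case: z {h} => ? ?; case: y.
  by have := nrm_Im (z - y); case: z {h} => ? ?; case: y.
apply/nrm_cvgP => e e0; have e2 : 0 < e / 2 by rewrite divr_gt0.
near=> y; apply: le_lt_trans (nrm_ReIm _) _; rewrite [ltRHS]splitr ltrD//.
  have : `|complex.Re z - complex.Re y| < e / 2 by near: y; exact: hr.
  by case: (z) => ? ?; case: (y).
have : `|complex.Im z - complex.Im y| < e / 2 by near: y; exact: hi.
by case: (z) => ? ?; case: (y).
Unshelve. all: by end_near. Qed.

End RealNorm.

Section Dot.
Variables (R : realType) (H : hilbertType R).
Implicit Types (x y z : H) (a : R[i]).

Lemma dotDl x y z : dot (x + y) z = dot x z + dot y z.
Proof. exact: linearDl. Qed.

Lemma dotDr x y z : dot z (x + y) = dot z x + dot z y.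
Proof. exact: linearDr. Qed.

Lemma dotZl a x z : dot (a *: x) z = a * dot x z.
Proof. exact: linearZl_LR. Qed.

Lemma dotZr a x z : dot z (a *: x) = a^*%C * dot z x.
Proof. exact: linearZr_LR. Qed.

Lemma dotNl x z : dot (- x) z = - dot x z.
Proof. exact: linearNl. Qed.

Lemma dotNr x z : dot z (- x) = - dot z x.
Proof. exact: linearNr. Qed.

Lemma dot0l x : dot 0 x = 0.
Proof. exact: linear0l. Qed.

Lemma dot0r x : dot x 0 = 0.
Proof. exact: linear0r. Qed.

Lemma dotBl x y z : dot (x - y) z = dot x z - dot y z.
Proof. by rewrite dotDl dotNl. Qed.

Lemma dotBr x y z : dot z (x - y) = dot z x - dot z y.
Proof. by rewrite dotDr dotNr. Qed.

Lemma dotC x y : dot x y = (dot y x)^*%C.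
Proof. by rewrite hermC expr0 mul1r. Qed.

Lemma dot_nrm x : dot x x = (nrm x ^+ 2)%:C.
Proof. by rewrite dotE nrmE rmorphXn. Qed.

Lemma dot_inj x y : (forall z, dot x z = dot y z) -> x = y.
Proof.
move=> h; apply/subr0_eq/nrm_eq0/eqP; rewrite -sqrf_eq0; apply/eqP.
by apply: (@complexI R); rewrite -dot_nrm dotBl h subrr.
Qed.

(** The inner product of the underlying real Hilbert space, in which the arguments
about distances and convexity take place. *)
Definition rdot x y : R := complex.Re (dot x y).

Lemma rdotC x y : rdot x y = rdot y x.
Proof. by rewrite /rdot dotC; case: (dot y x). Qed.

Lemma rdotDl x y z : rdot (x + y) z = rdot x z + rdot y z.
Proof. by rewrite /rdot dotDl; case: (dot x z) => ? ?; case: (dot y z). Qed.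

Lemma rdotNl x z : rdot (- x) z = - rdot x z.
Proof. by rewrite /rdot dotNl; case: (dot x z). Qed.

Lemma rdotBl x y z : rdot (x - y) z = rdot x z - rdot y z.
Proof. by rewrite rdotDl rdotNl. Qed.

Lemma rdotDr x y z : rdot z (x + y) = rdot z x + rdot z y.
Proof. by rewrite !(rdotC z) rdotDl. Qed.

Lemma rdotBr x y z : rdot z (x - y) = rdot z x - rdot z y.
Proof. by rewrite !(rdotC z) rdotBl. Qed.

Lemma rdotZl (t : R) x z : rdot (t%:C *: x) z = t * rdot x z.
Proof. by rewrite /rdot dotZl; case: (dot x z) => a b /=; rewrite mul0r subr0. Qed.

Lemma rdotZr (t : R) x z : rdot z (t%:C *: x) = t * rdot z x.
Proof. by rewrite !(rdotC z) rdotZl. Qed.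

Lemma rdot_nrm x : rdot x x = nrm x ^+ 2.
Proof. by rewrite /rdot dot_nrm. Qed.

Lemma Im_dot x y : complex.Im (dot x y) = rdot x ('i%C *: y).
Proof.
rewrite /rdot dotZr; case: (dot x y) => a b /=.
by rewrite mul0r sub0r mulN1r opprK.
Qed.

Lemma nrm_sqrB x y : nrm (x - y) ^+ 2 = nrm x ^+ 2 - 2 * rdot x y + nrm y ^+ 2.
Proof.
by rewrite -!rdot_nrm rdotBl !rdotBr (rdotC y x); ring.
Qed.

Lemma nrm_sqrD x y : nrm (x + y) ^+ 2 = nrm x ^+ 2 + 2 * rdot x y + nrm y ^+ 2.
Proof.
by rewrite -!rdot_nrm rdotDl !rdotDr (rdotC y x); ring.
Qed.

Lemma ler_dot x y : nrm (dot x y : R[i]^o) <= nrm x * nrm y.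
Proof.
set d : R[i]^o := dot x y; have [y0|yn0] := eqVneq (nrm y) 0.
  by rewrite y0 mulr0 /d (nrm_eq0 y0) dot0r nrm0.
have y2 : 0 < nrm y ^+ 2 by rewrite exprn_gt0// lt_def yn0 nrm_ge0.
(* Up to the factor [nrm y ^+ 2], this vector is the component of [x] orthogonal
   to [y]. *)
have : 0 <= nrm ((nrm y ^+ 2)%:C *: x - d *: y) ^+ 2 by rewrite sqr_ge0.
have -> : nrm ((nrm y ^+ 2)%:C *: x - d *: y) ^+ 2 =
   nrm y ^+ 2 * (nrm x ^+ 2 * nrm y ^+ 2 - nrm d ^+ 2).
  rewrite nrm_sqrB rdotZl !nrmZr nrmZ.
  have -> : rdot x (d *: y) = nrm d ^+ 2.
    rewrite /rdot dotZr mulrC -/d -sqr_normc.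
    by rewrite (nrmE d : `|dot x y| = (nrm d)%:C) -rmorphXn.
  rewrite !exprMn real_normK ?num_real// -/(nrm d); ring.
rewrite pmulr_rge0// subr_ge0 -exprMn ler_sqr// nnegrE ?mulr_ge0 ?nrm_ge0//.
Qed.

Lemma ler_rdot x y : `|rdot x y| <= nrm x * nrm y.
Proof. exact: le_trans (nrm_Re _) (ler_dot _ _). Qed.

Lemma parallelogram x y :
  nrm (x - y) ^+ 2 + nrm (x + y) ^+ 2 = 2 * nrm x ^+ 2 + 2 * nrm y ^+ 2.
Proof. by rewrite nrm_sqrB nrm_sqrD; ring. Qed.

End Dot.

Section UnbundledLinear.
Variables (K : pzRingType) (V W : lmodType K).

(** Operators are plain functions with a proof of linearity, so the
consequences of linearity are stated for unbundled functions. *)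
Lemma lin0 (f : V -> W) : linear f -> f 0 = 0.
Proof. by move=> lf; have := lf (-1) 0 0; rewrite scaler0 addr0 scaleN1r addNr. Qed.

Lemma linZ (f : V -> W) : linear f -> forall a x, f (a *: x) = a *: f x.
Proof. by move=> lf a x; have := lf a x 0; rewrite !addr0 (lin0 lf) addr0. Qed.

Lemma linD (f : V -> W) : linear f -> forall x y, f (x + y) = f x + f y.
Proof. by move=> lf x y; have := lf 1 x y; rewrite !scale1r. Qed.

Lemma linB (f : V -> W) : linear f -> forall x y, f (x - y) = f x - f y.
Proof. by move=> lf x y; rewrite (linD lf) -scaleN1r (linZ lf) scaleN1r. Qed.

End UnbundledLinear.

(** * Bounded operators and completeness *)

Section Bounded.
Variables (R : realType) (V W : normedModType R[i]).

Lemma continuous_bounded (f : V -> W) : linear f -> continuous f ->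
  exists2 C : R, 0 < C & forall x, nrm (f x) <= C * nrm x.
Proof.
move=> lf cf.
have /nrm_cvgP/(_ _ ltr01) := cf 0; rewrite (lin0 lf).
move=> /(@nbhs_norm0P _ V) [_/posnumP[e] he].
have [d d0 dE] : exists2 d : R, 0 < d & e%:num = d%:C.
  exists (complex.Re e%:num).
    by have : 0 < e%:num by []; rewrite ltcE => /andP[].
  by rewrite RRe_real// realE ltW.
exists (2 / d); first by rewrite divr_gt0.
move=> x; have [x0|xn0] := eqVneq (nrm x) 0.
  by rewrite (nrm_eq0 x0) (lin0 lf) !nrm0 mulr0.
have xp : 0 < nrm x by rewrite lt_def xn0 nrm_ge0.
have := he ((d / (2 * nrm x))%:C *: x) _.
have cp : 0 < d / (2 * nrm x) by rewrite divr_gt0// mulr_gt0.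
rewrite /= (linZ lf) sub0r nrmN nrmZr (gtr0_norm cp) => h.
have {h} : d / (2 * nrm x) * nrm (f x) < 1.
  apply: h; rewrite nrmE nrmZr dE ltcR (gtr0_norm cp).
  have -> : d / (2 * nrm x) * nrm x = d / 2 by field.
  lra.
rewrite mulrC -ltr_pdivlMr// => /ltW/le_trans; apply.
by rewrite mul1r invf_div mulrAC.
Qed.

Lemma bounded_continuous (f : V -> W) (C : R) : linear f ->
  (forall x, nrm (f x) <= C * nrm x) -> continuous f.
Proof.
move=> lf hC x; apply/nrm_cvgP => e e0.
have C1 : 0 < `|C| + 1 by rewrite ltr_wpDl.
have /nrm_cvgP/(_ (e / (`|C| + 1))) : y @[y --> x] --> x by exact: cvg_id.
move/(_ (divr_gt0 e0 C1)); rewrite !near_map; apply: filterS => y /=.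
rewrite -(linB lf) ltr_pdivlMr// => h; apply: le_lt_trans (hC _) _.
apply: le_lt_trans h; rewrite mulrC ler_wpM2l ?nrm_ge0//.
by rewrite (le_trans (ler_norm _))// lerDl.
Qed.

End Bounded.

Section Completeness.
Variables (R : realType).

Lemma nrm_cauchy_cvg (V : completeNormedModType R[i]) (F : set_system V)
    {FF : ProperFilter F} :
  (forall e : R, 0 < e -> exists x, \forall y \near F, nrm (x - y) < e) ->
  cvg F.
Proof.
move=> h; apply: cauchy_cvg; apply: cauchy_exP => e e0.
have eR : e = (complex.Re e)%:C by rewrite RRe_real// realE ltW.
have /h [x hx] : 0 < complex.Re e by rewrite -ltcR -eR.
exists x; rewrite /=; move: hx; apply: filterS => y.
by rewrite -ball_normE /= nrmE eR ltcR.
Qed.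

Lemma cvg_nrm (V : normedModType R[i]) T (F : set_system T) {FF : Filter F}
    (f : T -> V) x : f @ F --> x -> nrm (f t) @[t --> F] --> nrm x.
Proof.
move=> /nrm_cvgP h; apply/cvgrPdist_lt => e /h; rewrite !near_map.
by apply: filterS => t; exact: le_lt_trans (ler_nrmB _ _).
Qed.

Lemma closure_nrmP (V : normedModType R[i]) (C : set V) x :
  closure C x <-> forall e : R, 0 < e -> exists2 c, C c & nrm (x - c) < e.
Proof.
split=> [h e e0|h].
  have /nrm_cvgP/(_ _ e0)/h[c [? ?]] : (fun y => y) @ x --> x by exact: cvg_id.
  by exists c.
move=> A /nbhs_normP[e e0 he].
have eR : e = (complex.Re e)%:C by rewrite RRe_real// realE ltW.
have /h [c Cc hc] : 0 < complex.Re e by rewrite -ltcR -eR.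
by exists c; split=> //; apply: he => /=; rewrite nrmE eR ltcR.
Qed.

End Completeness.

(** * Convex projection, the Riesz theorem and adjoints *)

Section HilbertGeometry.
Variables (R : realType) (H : hilbertType R).
Implicit Types (x y z : H) (a : R[i]).

(** A sequence in the convex set whose distances to [x] tend to the infimum is
a Cauchy sequence by the parallelogram law.  Its limit [c0] minimizes the
distance on the segment from [c0] to any [c], whence an obtuse angle at [c0]. *)
Lemma nearest_point (C : set H) x : C !=set0 ->
    (forall c d (t : R), 0 <= t <= 1 -> C c -> C d -> C (c + t%:C *: (d - c))) ->
  exists2 c0, closure C c0 & forall c, C c -> rdot (x - c0) (c - c0) <= 0.
Proof.
move=> [d0 Cd0] cC; pose S := [set nrm (x - c) ^+ 2 | c in C].
have lbS : lbound S 0 by move=> _ [c _ <-]; rewrite sqr_ge0.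
have iS : has_inf S by split; [exists (nrm (x - d0) ^+ 2), d0 | exists 0].
set D := inf S.
have DC c : C c -> D <= nrm (x - c) ^+ 2.
  by move=> Cc; apply: ge_inf; [exists 0 | exists c].
have /choice[c hc] n : exists c, C c /\ nrm (x - c) ^+ 2 < D + n.+1%:R^-1.
  have n0 : 0 < (n.+1%:R : R)^-1 by rewrite invr_gt0.
  have [_ [c Cc <-] hc] := inf_adherent n0 iS.
  by exists c.
clearbody D.
have cauchy m n : nrm (c m - c n) ^+ 2 <= 2 * m.+1%:R^-1 + 2 * n.+1%:R^-1.
  have [Cm hm] := hc m; have [Cn hn] := hc n.
  have h2 : 0 <= (2^-1 : R) <= 1 by rewrite invr_ge0 ler0n invf_le1 ?ler1n.
  have := DC _ (cC _ _ _ h2 Cm Cn).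
  have := parallelogram (x - c n) (x - c m).
  have -> : x - c n - (x - c m) = c m - c n.
    by rewrite opprB addrC addrA subrK.
  have -> : x - c n + (x - c m) =
            2%:C *: (x - (c m + 2^-1%:C *: (c n - c m))).
    rewrite scalerBr scalerDr scalerA -rmorphM/= divff ?pnatr_eq0// scale1r.
    have two (y : H) : 2%:C *: y = y + y.
      by rewrite -[2]/(1 + 1 : R) rmorphD/= scalerDl scale1r.
    by rewrite !two [c n - c m]addrC [X in _ = _ - X]addrA addrK opprD [RHS]addrACA addrC.
  rewrite nrmZr exprMn real_normK ?num_real// => e1 e2.
  move: e1 e2 hm hn; move: m.+1%:R^-1 n.+1%:R^-1 => am an e1 e2 hm hn; lra.
have invn (e : R) : 0 < e -> \forall n \near \oo, n.+1%:R^-1 < e.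
  by move=> e0; near=> n; near: n; exact: near_infty_natSinv_lt (PosNum e0).
have /cvg_ex[/= c0 cvc] : cvg (c @ \oo).
  apply: nrm_cauchy_cvg => e e0.
  have e4 : 0 < e ^+ 2 / 4 by rewrite divr_gt0// exprn_gt0.
  have [N _ hN] := invn _ e4.
  exists (c N); rewrite near_map; near=> n.
  rewrite -(ltr_pXn2r (n := 2))// ?nnegrE ?nrm_ge0 ?ltW//.
  apply: le_lt_trans (cauchy N n) _.
  have := hN N (leqnn N); rewrite /= => h1.
  have : n.+1%:R^-1 < e ^+ 2 / 4 by near: n; exact: invn.
  by move: h1; move: (N.+1%:R^-1) (n.+1%:R^-1) => a b; lra.
exists c0.
  apply/closure_nrmP => e e0.
  have /nrm_cvgP/(_ _ e0)[n _ hn] := cvc.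
  by exists (c n); [have [] := hc n | have := hn n (leqnn n)].
move=> c1 Cc1.
have c0D : nrm (x - c0) ^+ 2 <= D.
  have h1 : nrm (x - c n) ^+ 2 @[n --> \oo] --> nrm (x - c0) ^+ 2.
    have h : nrm (x - c n) @[n --> \oo] --> nrm (x - c0).
      by apply: cvg_nrm; apply: cvgB => //; exact: cvg_cst.
    rewrite expr2; under eq_cvg do rewrite expr2.
    exact: cvgM.
  apply/ler_addgt0Pr => e e0; apply: (cvgr_to_le h1).
  near=> n; have [_ /ltW] := hc n; move/le_trans; apply; rewrite lerD2l ltW//.
  by near: n; exact: invn.
have Dt (t : R) : 0 <= t <= 1 -> D <= nrm (x - c0 - t%:C *: (c1 - c0)) ^+ 2.
  move=> t01.
  have h : nrm (x - c n - t%:C *: (c1 - c n)) @[n --> \oo] -->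
           nrm (x - c0 - t%:C *: (c1 - c0)).
    apply: cvg_nrm; apply: cvgB; first by apply: cvgB => //; exact: cvg_cst.
    by apply: cvgZl_tmp; apply: cvgB => //; exact: cvg_cst.
  have h1 : nrm (x - c n - t%:C *: (c1 - c n)) ^+ 2 @[n --> \oo] -->
           nrm (x - c0 - t%:C *: (c1 - c0)) ^+ 2.
    rewrite expr2; under eq_cvg do rewrite expr2.
    exact: cvgM.
  apply: (cvgr_to_ge h1); near=> n; rewrite -addrA -opprD; apply: DC.
  by apply: (cC) => //; have [] := hc n.
rewrite leNgt; apply/negP => r0.
set r := rdot _ _ in r0.
set K := nrm (c1 - c0) ^+ 2.
have K0 : 0 <= K by rewrite sqr_ge0.
(* For small [t], moving by [t] towards [c1] decreases the squared distance by
   [2 * t * r] up to the error [t ^+ 2 * K]. *)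
pose t := Num.min 1 (r / (K + 1)).
have K1 : 0 < K + 1 by rewrite ltr_wpDl.
have t0 : 0 < t by rewrite lt_min ltr01 divr_gt0.
have t1 : t <= 1 by rewrite ge_min lexx.
have tr : t * (K + 1) <= r.
  by rewrite -ler_pdivlMr// ge_min lexx orbT.
have := Dt t; rewrite (ltW t0) t1 => /(_ isT).
rewrite nrm_sqrB rdotZr nrmZr exprMn real_normK ?num_real// -/r -/K.
have : 0 < t * (2 * r - t * K); last by nra.
by rewrite mulr_gt0//; nra.
Unshelve. all: by end_near. Qed.

(** The imaginary part of an inner product is a real part after multiplying
one vector by the imaginary unit. *)
Lemma rdot_eq0 x (C : set H) : (forall a c, C c -> C (a *: c)) ->
  (forall c, C c -> rdot x c = 0) -> forall c, C c -> dot x c = 0.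
Proof.
move=> sC h c Cc; apply/eqP; rewrite eq_complex Im_dot; apply/andP; split.
  by apply/eqP; exact: h.
by apply/eqP; apply: h; exact: sC.
Qed.

Lemma orthogonal_projection_point (C : set H) x : C 0 ->
    (forall a c d, C c -> C d -> C (a *: c + d)) ->
  exists2 c0, closure C c0 & forall c, C c -> dot (x - c0) c = 0.
Proof.
move=> C0 lC.
have [||c0 c0C hc0] := @nearest_point C x; first by exists 0.
  move=> c d t _ Cc Cd; rewrite addrC; apply: (lC) => //.
  by rewrite addrC -scaleN1r; exact: lC.
exists c0 => //; apply: rdot_eq0 => [a c Cc|c Cc].
  by rewrite -[_ *: _]addr0; exact: lC.
(* A linear function of [s] that is bounded above vanishes. *)
have h (s : R) : s * rdot (x - c0) c <= rdot (x - c0) c0.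
  rewrite -rdotZr -subr_le0 -rdotBr; apply: hc0.
  by rewrite -[_ *: _]addr0; exact: lC.
set r := rdot _ _ in h *; set q := rdot (x - c0) c0 in h.
apply/eqP; apply/negPn/negP => r0.
by have := h ((q + 1) / r); rewrite divfK// gerDl ler10.
Qed.

Lemma closure_orthogonal_eq0 (C : set H) z :
  closure C z -> (forall c, C c -> dot z c = 0) -> z = 0.
Proof.
move=> /closure_nrmP cz oz; apply/nrm_eq0/eqP; rewrite eq_le nrm_ge0 andbT.
rewrite leNgt; apply/negP => z0.
have [c Cc hc] := cz _ z0.
have : rdot z (z - c) <= nrm z * nrm (z - c).
  exact: le_trans (ler_norm _) (ler_rdot _ _).
rewrite rdotBr rdot_nrm /rdot oz//= subr0 expr2 ler_pM2l// leNgt.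
by rewrite hc.
Qed.

Lemma orthogonal_projection (C : set H) : C 0 ->
    (forall a c d, C c -> C d -> C (a *: c + d)) ->
  exists P : H -> H, [/\ linear P, forall x, nrm (P x) <= nrm x,
    forall x, closure C (P x) &
    forall x c, C c -> dot (x - P x) c = 0].
Proof.
move=> C0 lC.
have /choice[P hP] x : exists y, closure C y /\ forall c, C c -> dot (x - y) c = 0.
  by have [y ? ?] := orthogonal_projection_point x C0 lC; exists y.
have clP x : closure C (P x) by have [] := hP x.
have oP x c : C c -> dot (x - P x) c = 0 by have [_] := hP x; apply.
have cllin a x y : closure C x -> closure C y -> closure C (a *: x + y).
  move=> /closure_nrmP hx /closure_nrmP hy; apply/closure_nrmP => e e0.
  have e2 : 0 < e / 2 by rewrite divr_gt0.
  set A := complex.Re `|a|.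
  have A0 : 0 <= A by rewrite -ler0c RRe_real ?normr_ge0// realE normr_ge0.
  have [c Cc hc] := hx _ (divr_gt0 e2 (ltr_wpDl A0 ltr01)).
  have [d Cd hd] := hy _ e2.
  exists (a *: c + d); first exact: lC.
  rewrite opprD addrACA -scalerBr (splitr e).
  apply: le_lt_trans (ler_nrmD _ _) _; rewrite ltrD// nrmZ -/A.
  move: hc; rewrite ltr_pdivlMr ?ltr_wpDl// mulrDr mulr1 mulrC.
  by apply: le_lt_trans; rewrite lerDl nrm_ge0.
have oPcl x z : closure C z -> dot (x - P x) z = 0.
  move=> cz; apply/eqP; apply/negPn/negP => d0.
  set w := x - P x in d0 *.
  have w0 : 0 < nrm w.
    rewrite lt_def nrm_ge0 andbT; apply: contra d0 => /eqP/nrm_eq0 ->.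
    by rewrite dot0l.
  have dn : 0 < nrm (dot w z : R[i]^o).
    by rewrite lt_def nrm_ge0 andbT; apply: contra d0 => /eqP/nrm_eq0 ->.
  move: cz => /closure_nrmP/(_ _ (divr_gt0 dn w0))[c Cc].
  rewrite ltr_pdivlMr// mulrC => /(le_lt_trans (ler_dot _ _)).
  by rewrite dotBr [dot w c]oP// subr0 ltxx.
exists P; split=> // [a x y|x].
  apply/esym/subr0_eq; apply: (@closure_orthogonal_eq0 C).
    have -> : a *: P x + P y - P (a *: x + y) = (- 1) *: P (a *: x + y) + (a *: P x + P y).
      by rewrite scaleN1r addrC.
    exact: (cllin _ _ _ (clP _) (cllin _ _ _ (clP _) (clP _))).
  move=> c Cc.
  have -> : a *: P x + P y - P (a *: x + y) =
    (a *: x + y - P (a *: x + y)) - (a *: (x - P x) + (y - P y)).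
    by rewrite scalerBr [X in _ = _ - X]addrACA -opprD opprB [RHS]addrC subrKA.
  by rewrite dotBl oP// dotDl dotZl !oP// mulr0 addr0 subr0.
have := rdot_nrm (P x); rewrite -[X in rdot X _](subrK x) rdotDl.
rewrite -opprB rdotNl [X in - X]/rdot oPcl//= oppr0 add0r => h.
have [->|p0] := eqVneq (nrm (P x)) 0; first exact: nrm_ge0.
have p1 : 0 < nrm (P x) by rewrite lt_def p0 nrm_ge0.
rewrite -(ler_pM2r p1) -expr2 -h.
exact: le_trans (ler_norm _) (ler_rdot _ _).
Qed.

(** A multiple of the point of the hyperplane [f = 1] nearest to the origin
represents [f], because that point is orthogonal to the kernel. *)
Lemma riesz (f : H -> R[i]^o) (K : R) : linear f ->
  (forall x, nrm (f x) <= K * nrm x) -> exists y, forall x, f x = dot x y.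
Proof.
move=> lf bf; have [[x0 hx0]|nx] := pselect (exists x, f x != 0); last first.
  exists 0 => x; rewrite dot0r; apply/eqP/negPn/negP => h; apply: nx.
  by exists x.
have [||c0 c0C hc0] := @nearest_point [set x | f x = 1] 0.
- by exists ((f x0)^-1 *: x0); rewrite /= (linZ lf) -[LHS]/(_ * _) mulVf.
- move=> c d t _ /= fc fd.
  by rewrite (linD lf) (linZ lf) (linB lf) fc fd subrr scaler0 addr0.
have fc0 : f c0 = 1.
  have : closure [set (1 : R[i]^o)] (f c0).
    have cf := bounded_continuous lf bf.
    move=> A /cf /c0C [c [fc Ac]]; exists 1; split=> //.
    by rewrite -fc.
  move=> /closure_nrmP h; apply/subr0_eq/nrm_eq0/eqP; rewrite eq_le nrm_ge0 andbT.
  by apply/ler_addgt0Pr => e /h[_ -> /ltW]; rewrite add0r.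
have ker x : f x = 0 -> dot c0 x = 0.
  apply: (@rdot_eq0 c0 [set x | f x = 0]) x => /= [a c fc|c fc].
    by rewrite (linZ lf) fc scaler0.
  have h (s : R) : s * rdot c0 c <= 0.
    have := hc0 (c0 - s%:C *: c); rewrite /= (linB lf) (linZ lf) fc scaler0 subr0.
    rewrite [c0 - _ - _]addrAC subrr !sub0r rdotNl rdotC rdotNl opprK.
    by rewrite rdotZl rdotC; exact.
  apply/eqP; apply/negPn/negP => r0.
  by have := h (rdot c0 c)^-1; rewrite mulVf// ler10.
have n0 : nrm c0 != 0.
  apply/eqP => /nrm_eq0 e0; move: fc0; rewrite e0 (lin0 lf) => /eqP.
  by rewrite eq_sym oner_eq0.
exists ((nrm c0 ^- 2)%:C *: c0) => x.
have /ker : f (x - f x *: c0) = 0.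
  by rewrite (linB lf) (linZ lf) fc0 -[X in _ - X]/(_ * _) mulr1 subrr.
rewrite dotBr => /subr0_eq hx.
rewrite dotZr conjc_real (dotC x) hx dotZr dot_nrm.
have -> : ((f x)^*%C * (nrm c0 ^+ 2)%:C)^*%C = (f x : R[i]) * (nrm c0 ^+ 2)%:C.
  by rewrite rmorphM/= conjcK oppr0.
by rewrite mulrCA -rmorphM/= mulVf ?expf_neq0// mulr1.
Qed.

Lemma form_operator (B : H -> H -> R[i]^o) (K : R) :
    (forall v, linear (B^~ v)) ->
    (forall u a v w, B u (a *: v + w) = a^*%C * B u v + B u w) ->
    (forall u v, nrm (B u v) <= K * nrm u * nrm v) ->
  exists T : H -> H, [/\ linear T, forall u, nrm (T u) <= K * nrm u &
    forall u v, dot (T u) v = B u v].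
Proof.
move=> lB sB bB.
have /choice[T hT] u : exists y, forall v, dot y v = B u v.
  have [|v|y hy] := @riesz (fun v => (B u v)^*%C) (K * nrm u).
  - by move=> a v w; rewrite sB rmorphD rmorphM/= conjcK.
  - by rewrite /nrm normcJ; exact: bB.
  by exists y => v; rewrite dotC -hy conjcK.
exists T; split => [a u v|u|//].
  by apply: dot_inj => w; rewrite dotDl dotZl !hT lB.
have [->|p0] := eqVneq (nrm (T u)) 0.
  have [->|u0] := eqVneq u 0; first by rewrite nrm0 mulr0.
  have u1 := nrm_gt0 u0.
  by rewrite -(pmulr_lge0 _ u1); exact: le_trans (nrm_ge0 _) (bB u u).
have p1 : 0 < nrm (T u) by rewrite lt_def p0 nrm_ge0.
rewrite -(ler_pM2r p1) -expr2 -rdot_nrm /rdot hT.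
exact: le_trans (ler_norm _) (le_trans (nrm_Re _) (bB _ _)).
Qed.

Lemma adjoint_exists (f : H -> H) : bounded_operator f ->
  exists2 g, bounded_operator g & adjoint f g.
Proof.
move=> [lf cf]; have [C C0 bf] := continuous_bounded lf cf.
have [|||g [lg bg hg]] := @form_operator (fun u v => dot u (f v)) C.
- by move=> v a x y; rewrite dotDl dotZl.
- by move=> u a v w; rewrite lf dotDr dotZr.
- move=> u v; apply: le_trans (ler_dot _ _) _.
  by rewrite mulrAC [leRHS]mulrC ler_wpM2l ?nrm_ge0.
exists g; first by split=> //; exact: bounded_continuous bg.
by move=> x y; rewrite dotC -hg -dotC.
Qed.

End HilbertGeometry.

(** * The Hilbert space of square-summable sequences *)

Section SquareSummable.
Variables (R : realType) (H : hilbertType R).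
Implicit Types (u v w : nat -> H) (a : R[i]).

Definition l2_pred : {pred nat -> H} :=
  fun u => `[< exists K : R, forall n, \sum_(k < n) nrm (u k) ^+ 2 <= K >].

Lemma l2_predP u :
  reflect (exists K : R, forall n, \sum_(k < n) nrm (u k) ^+ 2 <= K)
    (u \in l2_pred).
Proof. exact: asboolP. Qed.

Lemma l2_cvgP u :
  u \in l2_pred <-> cvgn (series (fun k => nrm (u k) ^+ 2)).
Proof.
have nd : nondecreasing_seq (series (fun k => nrm (u k) ^+ 2)).
  by apply: nondecreasing_series => k _; rewrite sqr_ge0.
split=> [/l2_predP[K hK]|cu].
  apply: nondecreasing_is_cvgn => //; exists K => _ [n _ <-].
  by rewrite seriesEord; exact: hK.
apply/l2_predP; exists (limn (series (fun k => nrm (u k) ^+ 2))) => n.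
by have := nondecreasing_cvgn_le nd cu n; rewrite seriesEord.
Qed.

Lemma l2_submod_closed : submod_closed l2_pred.
Proof.
split.
  by apply/l2_predP; exists 0 => n; rewrite big1// => k _; rewrite nrm0 expr0n.
move=> a u v /l2_predP[K hK] /l2_predP[L hL]; apply/l2_predP.
set A := complex.Re `|a|.
exists (2 * A ^+ 2 * K + 2 * L) => n.
apply: (@le_trans _ _ (\sum_(k < n) (2 * A ^+ 2 * nrm (u k) ^+ 2 + 2 * nrm (v k) ^+ 2))).
  apply: ler_sum => k _; have := parallelogram (a *: u k) (v k).
  rewrite nrmZ -/A exprMn => h.
  have := sqr_ge0 (nrm (a *: u k - v k)).
  have -> : (a *: u + v) k = a *: u k + v k by [].
  lra.
rewrite big_split/= -!mulr_sumr lerD//.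
  by apply: ler_wpM2l; [rewrite mulr_ge0// sqr_ge0 | exact: hK].
by apply: ler_wpM2l => //; exact: hL.
Qed.

HB.instance Definition _ :=
  GRing.isSubmodClosed.Build R[i] (nat -> H) l2_pred
    (GRing.submod_closed_semi l2_submod_closed).

(** The Hilbert space direct sum of countably many copies of [H]. *)
Definition l2 := {u : nat -> H | u \in l2_pred}.

HB.instance Definition _ := SubType.on l2.
HB.instance Definition _ := Choice.on l2.
HB.instance Definition _ := [SubChoice_isSubLmodule of l2 by <:].

Definition entry (k : nat) (x : l2) : H := val x k.

Lemma entryD k x y : entry k (x + y) = entry k x + entry k y.
Proof. by []. Qed.

Lemma entryZ k a x : entry k (a *: x) = a *: entry k x.
Proof. by []. Qed.

Lemma entryB k x y : entry k (x - y) = entry k x - entry k y.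
Proof. by []. Qed.

Lemma l2_ext (x y : l2) : (forall k, entry k x = entry k y) -> x = y.
Proof. by move=> h; apply: val_inj; apply/funext => k; exact: h. Qed.

Lemma rdot_series_cvg u v : u \in l2_pred -> v \in l2_pred ->
  cvgn (series (fun k => rdot (u k) (v k))).
Proof.
move=> /l2_cvgP cu /l2_cvgP cv; apply: normed_cvg.
apply: (@series_le_cvg _ _ (fun k => nrm (u k) ^+ 2 + nrm (v k) ^+ 2)) => //.
- by move=> k /=.
- by move=> k; rewrite addr_ge0// sqr_ge0.
- move=> k /=; apply: le_trans (ler_rdot _ _) _.
  have := sqr_ge0 (nrm (u k) - nrm (v k)).
  have := sqr_ge0 (nrm (u k)); have := sqr_ge0 (nrm (v k)).
  by move: (nrm (u k)) (nrm (v k)) => p q; nra.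
- exact: is_cvg_seriesD.
Qed.

Lemma Re_sum (I : Type) (r : seq I) (P : pred I) (F : I -> R[i]) :
  complex.Re (\sum_(i <- r | P i) F i) = \sum_(i <- r | P i) complex.Re (F i).
Proof. by elim/big_rec2: _ => // i _ z _ <-; case: (F i) => ? ?; case: z. Qed.

Lemma Im_sum (I : Type) (r : seq I) (P : pred I) (F : I -> R[i]) :
  complex.Im (\sum_(i <- r | P i) F i) = \sum_(i <- r | P i) complex.Im (F i).
Proof. by elim/big_rec2: _ => // i _ z _ <-; case: (F i) => ? ?; case: z. Qed.

Lemma cvg_complex_seriesP (f : nat -> R[i]^o) (z : R[i]^o) :
  series f @ \oo --> z <->
  (series (fun k => complex.Re (f k)) @ \oo --> complex.Re z) /\
  (series (fun k => complex.Im (f k)) @ \oo --> complex.Im z).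
Proof.
have eR : series (fun k => complex.Re (f k)) = (fun n => complex.Re (series f n)).
  by apply/funext => n; rewrite !seriesEnat /= Re_sum.
have eI : series (fun k => complex.Im (f k)) = (fun n => complex.Im (series f n)).
  by apply/funext => n; rewrite !seriesEnat /= Im_sum.
by rewrite eR eI; exact: cvg_complexP.
Qed.

Lemma dot_series_cvg u v : u \in l2_pred -> v \in l2_pred ->
  cvgn (series (fun k => dot (u k) (v k) : R[i]^o)).
Proof.
move=> lu lv.
have liv : 'i%C *: v \in l2_pred by rewrite rpredZ.
have /cvg_ex[p hp] := rdot_series_cvg lu lv.
have /cvg_ex[q hq] := rdot_series_cvg lu liv.
apply/cvg_ex; exists ((p +i* q : R[i]) : R[i]^o); apply/cvg_complex_seriesP.
by split=> //=; under eq_fun do rewrite Im_dot.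
Qed.

Definition l2dot (x y : l2) : R[i] :=
  limn (series (fun k => dot (entry k x) (entry k y) : R[i]^o)).

Lemma l2dot_cvg x y :
  series (fun k => dot (entry k x) (entry k y) : R[i]^o) @ \oo --> (l2dot x y : R[i]^o).
Proof. exact: dot_series_cvg (valP x) (valP y). Qed.

Lemma l2dot_lim x y (z : R[i]^o) :
  series (fun k => dot (entry k x) (entry k y) : R[i]^o) @ \oo --> z ->
  l2dot x y = z.
Proof. by apply: cvg_lim; exact: norm_hausdorff. Qed.

Lemma l2dot_linear y : linear (fun x => l2dot x y : R[i]^o).
Proof.
move=> a x z; apply: l2dot_lim.
rewrite (_ : series _ = a *: series (fun k => dot (entry k x) (entry k y) : R[i]^o)
   + series (fun k => dot (entry k z) (entry k y) : R[i]^o)).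
  by apply: cvgD; [apply: cvgZl_tmp|]; exact: l2dot_cvg.
rewrite -seriesZ -seriesD; congr series; apply/funext => k /=.
by rewrite entryD entryZ dotDl dotZl.
Qed.

Lemma l2dotC x y : l2dot x y = (l2dot y x)^*%C.
Proof.
apply: l2dot_lim.
have /cvg_complex_seriesP[k1 k2] := @l2dot_cvg y x.
apply/cvg_complex_seriesP; split.
  have -> : complex.Re (l2dot y x)^*%C = complex.Re (l2dot y x).
    by case: (l2dot y x).
  have -> // : (fun k => complex.Re (dot (entry k x) (entry k y))) =
          (fun k => complex.Re (dot (entry k y) (entry k x))).
  by apply/funext => k; rewrite dotC; case: (dot (entry k y) _).
have -> : complex.Im (l2dot y x)^*%C = - complex.Im (l2dot y x).
  by case: (l2dot y x).
have -> : (fun k => complex.Im (dot (entry k x) (entry k y))) =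
          - (fun k => complex.Im (dot (entry k y) (entry k x))).
  by apply/funext => k; rewrite dotC fctE; case: (dot (entry k y) _).
by rewrite seriesN; exact: cvgN.
Qed.

Definition l2sq (x : l2) : R := limn (series (fun k => nrm (entry k x) ^+ 2)).

Lemma l2sq_cvg x : series (fun k => nrm (entry k x) ^+ 2) @ \oo --> l2sq x.
Proof. by apply/l2_cvgP; exact: (valP x). Qed.

Lemma l2dotxx x : l2dot x x = (l2sq x)%:C.
Proof.
apply: l2dot_lim.
apply/cvg_complex_seriesP; split=> /=.
  by under eq_fun do rewrite dot_nrm; exact: l2sq_cvg.
under eq_fun do rewrite dot_nrm /=.
rewrite (_ : series _ = cst 0); first exact: cvg_cst.
by apply/funext => n; rewrite seriesEnat /= big1.
Qed.

Lemma l2sq_ge x n : \sum_(k < n) nrm (entry k x) ^+ 2 <= l2sq x.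
Proof.
have -> : \sum_(k < n) nrm (entry k x) ^+ 2 =
    series (fun k => nrm (entry k x) ^+ 2) n by rewrite seriesEord.
apply: nondecreasing_cvgn_le; last exact: (cvgP _ (@l2sq_cvg x)).
by apply: nondecreasing_series => k _; rewrite sqr_ge0.
Qed.

Lemma l2sq_le x (K : R) :
  (forall n, \sum_(k < n) nrm (entry k x) ^+ 2 <= K) -> l2sq x <= K.
Proof.
move=> h; apply: (cvgr_to_le (@l2sq_cvg x)); near=> n.
by rewrite seriesEord; exact: h.
Unshelve. all: by end_near. Qed.

Lemma l2sq_ge0 x : 0 <= l2sq x.
Proof. by have := l2sq_ge x 0; rewrite big_ord0. Qed.

Lemma entry_sq_le x k : nrm (entry k x) ^+ 2 <= l2sq x.
Proof.
apply: le_trans (l2sq_ge x k.+1); rewrite big_ord_recr/= lerDr.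
by apply: sumr_ge0 => i _; rewrite sqr_ge0.
Qed.

Lemma l2sqZ a x : l2sq (a *: x) = complex.Re `|a| ^+ 2 * l2sq x.
Proof.
apply: cvg_lim; first exact: Rhausdorff.
rewrite (_ : series _ = complex.Re `|a| ^+ 2 *: series (fun k => nrm (entry k x) ^+ 2)).
  by apply: cvgZl_tmp; exact: l2sq_cvg.
rewrite -seriesZ; congr series; apply/funext => k /=.
by rewrite entryZ nrmZ exprMn.
Qed.

Lemma l2sqD x y : l2sq (x + y) = l2sq x + 2 * complex.Re (l2dot x y) + l2sq y.
Proof.
have RD (z t : R[i]) : complex.Re (z + t) = complex.Re z + complex.Re t.
  by case: z; case: t.
have sq z : l2sq z = complex.Re (l2dot z z) by rewrite l2dotxx.
have lD (u v w : l2) : l2dot (u + v) w = l2dot u w + l2dot v w.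
  by have := linD (l2dot_linear w) u v.
have CR (z : R[i]) : complex.Re z^*%C = complex.Re z by case: z.
rewrite !sq lD RD (l2dotC x) (l2dotC y) !CR !lD !RD (l2dotC y x) CR.
ring.
Qed.

Definition l2norm (x : l2) : R[i] := (Num.sqrt (l2sq x))%:C.

(** The polynomial [t |-> l2sq (x + t y)] is nonnegative, so its discriminant
is not positive. *)
Lemma l2dot_le x y : complex.Re (l2dot x y) <= Num.sqrt (l2sq x) * Num.sqrt (l2sq y).
Proof.
rewrite -sqrtrM ?l2sq_ge0//.
apply: le_trans (ler_norm _) _; rewrite -sqrtr_sqr ler_sqrt; last first.
  by rewrite mulr_ge0 ?l2sq_ge0.
set b := complex.Re _.
have h (t : R) : 0 <= l2sq x + 2 * t * b + t ^+ 2 * l2sq y.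
  have := l2sq_ge0 (x + t%:C *: y); rewrite l2sqD l2sqZ.
  rewrite normc_def /= expr0n addr0 sqrtr_sqr real_normK ?num_real//.
  have -> : complex.Re (l2dot x (t%:C *: y)) = t * b.
    rewrite l2dotC; have -> := linZ (l2dot_linear x) t%:C y.
    rewrite /b (l2dotC x y); case: (l2dot y x) => p q /=.
    by rewrite mul0r subr0.
  by rewrite mulrA.
have [y0|y0] := eqVneq (l2sq y) 0.
  rewrite y0 mulr0 in h *.
  have [->|b0] := eqVneq b 0; first by rewrite expr0n.
  (* An affine function that is bounded below is constant. *)
  have := h (- (l2sq x + 1) / (2 * b)); rewrite mulr0.
  have -> : 2 * (- (l2sq x + 1) / (2 * b)) * b = - (l2sq x + 1) by field.
  lra.
have yp : 0 < l2sq y by rewrite lt_def y0 l2sq_ge0.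
(* The polynomial is smallest at this point. *)
have := h (- b / l2sq y).
have -> : l2sq x + 2 * (- b / l2sq y) * b + (- b / l2sq y) ^+ 2 * l2sq y =
   (l2sq x * l2sq y - b ^+ 2) / l2sq y by field.
by rewrite pmulr_lge0 ?invr_gt0// subr_ge0.
Qed.

Lemma ler_l2normD x y : l2norm (x + y) <= l2norm x + l2norm y.
Proof.
rewrite /l2norm -rmorphD lecR/=.
rewrite -(ler_pXn2r (n := 2))// ?nnegrE ?addr_ge0 ?sqrtr_ge0//.
rewrite sqrrD !sqr_sqrtr ?l2sq_ge0// l2sqD.
by have := l2dot_le x y; lra.
Qed.

Lemma l2normZ a x : l2norm (a *: x) = `|a| * l2norm x.
Proof.
have nA : `|a| = (complex.Re `|a|)%:C by rewrite RRe_real// realE normr_ge0.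
rewrite nA -rmorphM/=; congr (_%:C).
have A0 : 0 <= complex.Re `|a| by rewrite -ler0c -nA.
by rewrite l2sqZ sqrtrM ?sqr_ge0// sqrtr_sqr (ger0_norm A0).
Qed.

Lemma l2norm_eq0 x : l2norm x = 0 -> x = 0.
Proof.
case=> /eqP; rewrite sqrtr_eq0 => h; apply: l2_ext => k.
apply/nrm_eq0/eqP; rewrite -sqrf_eq0 eq_le sqr_ge0 andbT.
exact: le_trans (entry_sq_le x k) h.
Qed.

HB.instance Definition _ :=
  Lmodule_isNormed.Build R[i] l2 ler_l2normD l2normZ l2norm_eq0.

Lemma nrm_l2 (x : l2) : nrm x = Num.sqrt (l2sq x).
Proof. by []. Qed.

Lemma nrm_l2_sq (x : l2) : nrm x ^+ 2 = l2sq x.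
Proof. by rewrite nrm_l2 sqr_sqrtr ?l2sq_ge0. Qed.

Lemma nrm_entry k (x : l2) : nrm (entry k x) <= nrm x.
Proof.
by rewrite -(ler_pXn2r (n := 2))// ?nnegrE ?nrm_ge0// nrm_l2_sq entry_sq_le.
Qed.

(** A Cauchy filter converges in each entry. Distances to the limit are
controlled by the partial sums, in each of which the limit involves finitely
many entries. *)
Lemma l2_complete (F : set_system l2) : ProperFilter F -> cauchy F -> cvg F.
Proof.
move=> FF /cauchyP cF.
have {}cF e : 0 < e -> exists x, \forall y \near F, nrm (x - y) < e.
  move=> e0; have e0c : (0 : R[i]) < e%:C by rewrite ltcR.
  have [x hx] := cF _ e0c; exists x; move: hx; rewrite /=; apply: filterS => y.
  by rewrite -ball_normE /= nrmE ltcR.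
have /choice[l hl] k : exists y : H, entry k x @[x --> F] --> y.
  apply/cvg_ex; apply: nrm_cauchy_cvg => e /cF[x hx].
  exists (entry k x); rewrite near_map; move: hx; apply: filterS => y.
  by apply: le_lt_trans; rewrite -entryB nrm_entry.
have part x e : 0 < e -> (\forall y \near F, nrm (x - y) < e) ->
    forall n, \sum_(k < n) nrm (entry k x - l k) ^+ 2 <= e ^+ 2.
  move=> e0 hx n.
  have h : \sum_(k < n) nrm (entry k x - entry k y) ^+ 2 @[y --> F] -->
      \sum_(k < n) nrm (entry k x - l k) ^+ 2.
    apply: cvg_big => [|k _]; first exact: add_continuous.
    have h : nrm (entry k x - entry k y) @[y --> F] --> nrm (entry k x - l k).
      by apply: cvg_nrm; apply: cvgB; [exact: cvg_cst | exact: hl].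
    rewrite expr2; under eq_cvg do rewrite expr2.
    exact: cvgM.
  apply: (cvgr_to_le h); move: hx; apply: filterS => y hy.
  apply: le_trans (l2sq_ge (x - y) n) _.
  by rewrite -nrm_l2_sq ler_sqr ?nnegrE ?nrm_ge0 ?ltW.
have ll : l \in l2_pred.
  have [x hx] := cF _ ltr01.
  have -> : l = val x - (val x - l) by rewrite opprB addrC subrK.
  rewrite rpredB ?(valP x)//; apply/l2_predP; exists (1 ^+ 2) => n.
  exact: part hx n.
pose L : l2 := exist (fun u => u \in l2_pred) l ll.
apply/cvg_ex; exists L; apply/nrm_cvgP => e e0.
have e2 : 0 < e / 2 by rewrite divr_gt0.
have [x hx] := cF _ e2; move: (hx); apply: filterS => y hy.
have hL : nrm (L - x) <= e / 2.
  rewrite nrm_subC -(ler_pXn2r (n := 2))// ?nnegrE ?nrm_ge0 ?(ltW e2)//.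
  by rewrite nrm_l2_sq; apply: l2sq_le => n; exact: (part x).
apply: le_lt_trans (ler_nrm_dist x _ _) _; rewrite [ltRHS](splitr e).
exact: ler_ltD.
Qed.

HB.instance Definition _ := Uniform_isComplete.Build l2 l2_complete.

Lemma l2dot_is_bilinear : bilinear_for
  (GRing.Scale.Law.clone _ _ *%R _)
  (GRing.Scale.Law.clone _ _ (Num.conj \; *%R) _) l2dot.
Proof.
split=> [y|x] a u v /=; first exact: l2dot_linear.
by rewrite l2dotC l2dot_linear !(l2dotC x) rmorphD rmorphM.
Qed.

HB.instance Definition _ :=
  bilinear_isBilinear.Build R[i] l2 l2 R[i] _ _ l2dot l2dot_is_bilinear.

Lemma l2dot_herm (x y : l2) : l2dot x y = (-1) ^+ false * Num.conj (l2dot y x).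
Proof. by rewrite expr0 mul1r l2dotC. Qed.

HB.instance Definition _ :=
  isHermitianSesquilinear.Build R[i] l2 false Num.conj l2dot l2dot_herm.

Lemma l2dot_gt0 (x : l2) : x != 0 -> 0 < l2dot x x.
Proof.
move=> x0; rewrite l2dotxx ltcR lt_def l2sq_ge0 andbT.
by apply: contra x0 => /eqP h; apply/eqP/l2norm_eq0; rewrite /l2norm h sqrtr0.
Qed.

HB.instance Definition _ := isDotProduct.Build R[i] l2 l2dot l2dot_gt0.

Lemma l2dotE (x : l2) : l2dot x x = `|x| ^+ 2.
Proof. by rewrite l2dotxx nrmE -rmorphXn/= nrm_l2_sq. Qed.

HB.instance Definition _ := CompleteNormedModule_isHilbert.Build R l2 l2dotE.


Lemma dot_l2_cvg (x y : l2) :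
  series (fun k => dot (entry k x) (entry k y) : R[i]^o) @ \oo --> (dot x y : R[i]^o).
Proof. exact: l2dot_cvg. Qed.

Lemma dot_l2_lim (x y : l2) (z : R[i]^o) :
  series (fun k => dot (entry k x) (entry k y) : R[i]^o) @ \oo --> z ->
  dot x y = z.
Proof. exact: l2dot_lim. Qed.

Lemma l2inj_subproof k (h : H) : (fun j => if j == k then h else 0) \in l2_pred.
Proof.
apply/l2_predP; exists (nrm h ^+ 2) => n.
rewrite (eq_bigr (fun j : 'I_n => if (j : nat) == k then nrm h ^+ 2 else 0)).
  case: (ltnP k n) => kn.
    rewrite (bigD1 (Ordinal kn))//= eqxx big1 ?addr0// => i ik.
    by rewrite ifN//; apply: contra ik => /eqP ik; apply/eqP/val_inj.
  rewrite big1 ?sqr_ge0// => i _; rewrite ifN//.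
  by apply: contraTneq kn => <-; rewrite -ltnNge.
by move=> i _; case: eqP => // _; rewrite nrm0 expr0n.
Qed.

Definition l2inj k (h : H) : l2 :=
  exist (fun u => u \in l2_pred) _ (l2inj_subproof k h).

Lemma entry_inj j k h : entry j (l2inj k h) = if j == k then h else 0.
Proof. by []. Qed.

Lemma entry_injE k h : entry k (l2inj k h) = h.
Proof. by rewrite entry_inj eqxx. Qed.

Lemma l2inj_linear k : linear (l2inj k).
Proof.
move=> a x y; apply: l2_ext => j; rewrite entryD entryZ !entry_inj.
by case: eqP => // _; rewrite scaler0 addr0.
Qed.

Lemma dot_injr x k h : dot x (l2inj k h) = dot (entry k x) h.
Proof.
apply: dot_l2_lim; apply: cvg_near_cst; near=> n.
have kn : (k < n)%N by near: n; exact: nbhs_infty_gt.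
rewrite seriesEord /= (bigD1 (Ordinal kn))//= entry_injE big1 ?addr0// => i ik.
rewrite entry_inj ifN ?dot0r//; apply: contra ik => /eqP ik; apply/eqP/val_inj.
Unshelve. all: by end_near. Qed.

Lemma dot_injl x k h : dot (l2inj k h) x = dot h (entry k x).
Proof. by rewrite dotC dot_injr -dotC. Qed.

Lemma nrm_inj k h : nrm (l2inj k h) = nrm h.
Proof.
apply/eqP; rewrite -(eqrXn2 (n := 2))// ?nrm_ge0//; apply/eqP.
by rewrite -!rdot_nrm /rdot dot_injr entry_injE.
Qed.

Definition trunc n (x : l2) : l2 := \sum_(k < n) l2inj k (entry k x).

Lemma dot_trunc n x y : dot y (trunc n x) = \sum_(k < n) dot (entry k y) (entry k x).
Proof.
rewrite /trunc; elim: n => [|n IHn]; first by rewrite !big_ord0 dot0r.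
by rewrite !big_ord_recr /= dotDr IHn dot_injr.
Qed.

Lemma entry_trunc n x k : entry k (trunc n x) = if (k < n)%N then entry k x else 0.
Proof.
apply: dot_inj => h; rewrite -dot_injr dotC dot_trunc.
rewrite (eq_bigr (fun j : 'I_n => if (j : nat) == k then dot h (entry k x) else 0)).
  case: (ltnP k n) => kn.
    rewrite (bigD1 (Ordinal kn))//= eqxx big1 ?addr0 -?dotC// => i ik.
    by rewrite ifN//; apply: contra ik => /eqP ik; apply/eqP/val_inj.
  rewrite big1 ?dot0l ?conjc0// => i _; rewrite ifN//.
  by apply: contraTneq kn => <-; rewrite -ltnNge.
by move=> i _; rewrite entry_inj; case: eqP => [->//|_]; rewrite dot0l.
Qed.

(** The squared distance from [x] to a truncation is the tail of the series of
[l2sq x]. *)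
Lemma trunc_close x e : 0 < e -> exists n, nrm (x - trunc n x) < e.
Proof.
move=> e0; have e2 : 0 < e ^+ 2 by rewrite exprn_gt0.
have /cvgrPdist_lt/(_ _ e2)[n _ /(_ n (leqnn n))] := @l2sq_cvg x.
rewrite seriesEord /= => hn; exists n.
rewrite -(ltr_pXn2r (n := 2))// ?nnegrE ?nrm_ge0 ?(ltW e0)//.
have E : rdot x (trunc n x) = \sum_(k < n) nrm (entry k x) ^+ 2.
  rewrite /rdot dot_trunc Re_sum; apply: eq_bigr => k _.
  by rewrite dot_nrm.
have E2 : nrm (trunc n x) ^+ 2 = \sum_(k < n) nrm (entry k x) ^+ 2.
  rewrite -rdot_nrm /rdot dot_trunc Re_sum; apply: eq_bigr => k _.
  by rewrite entry_trunc ltn_ord dot_nrm.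
rewrite nrm_sqrB E E2 nrm_l2_sq; apply: le_lt_trans hn.
apply: le_trans (ler_norm _).
by move: (\sum_(k < n) _) (l2sq x) => p q; lra.
Qed.

End SquareSummable.
Arguments l2 {R} H.

(** * Amplification of operators *)

Lemma cvg_eq_fun T (U : nbhsType) (F : set_system T) (f g : T -> U) (x : U) :
  f =1 g -> f @ F --> x -> g @ F --> x.
Proof. by move=> /funext ->. Qed.

Section Amplification.
Variables (R : realType) (H : hilbertType R).

(** The operator [T] applied to every entry, that is, [T] tensored with the
identity. The default value stands for sequences that are not square-summable.
*)
Definition amp (T : H -> H) (u : l2 H) : l2 H :=
  insubd (0 : l2 H) (fun k => T (entry k u)).

Lemma amp_subproof (T : H -> H) (u : l2 H) : bounded_operator T ->
  (fun k => T (entry k u)) \in @l2_pred R H.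
Proof.
move=> [lT cT]; have [C C0 bT] := continuous_bounded lT cT.
apply/l2_predP; exists (C ^+ 2 * l2sq u) => n.
apply: le_trans (ler_wpM2l _ (l2sq_ge u n)); last by rewrite sqr_ge0.
rewrite mulr_sumr; apply: ler_sum => k _; rewrite -exprMn.
by rewrite ler_sqr ?nnegrE ?nrm_ge0 ?mulr_ge0 ?nrm_ge0// ltW.
Qed.

Lemma entry_amp (T : H -> H) k u : bounded_operator T ->
  entry k (amp T u) = T (entry k u).
Proof. by move=> bT; rewrite /entry /amp val_insubd amp_subproof. Qed.

Lemma amp_linear (T : H -> H) : bounded_operator T -> linear (amp T).
Proof.
move=> bT a u v; apply: l2_ext => k.
by rewrite entryD entryZ !entry_amp// entryD entryZ bT.1.
Qed.

Lemma nrm_amp (T : H -> H) (C : R) u : bounded_operator T -> 0 <= C ->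
  (forall h, nrm (T h) <= C * nrm h) -> nrm (amp T u) <= C * nrm u.
Proof.
move=> bT C0 hC.
rewrite -(ler_pXn2r (n := 2))// ?nnegrE ?mulr_ge0 ?nrm_ge0// exprMn !nrm_l2_sq.
apply: l2sq_le => n; apply: le_trans (ler_wpM2l _ (l2sq_ge u n)); last by rewrite sqr_ge0.
rewrite mulr_sumr; apply: ler_sum => k _; rewrite -exprMn entry_amp//.
by rewrite ler_sqr ?nnegrE ?nrm_ge0 ?mulr_ge0 ?nrm_ge0.
Qed.

Lemma amp_inj (T : H -> H) k h : bounded_operator T ->
  amp T (l2inj k h) = l2inj k (T h).
Proof.
move=> bT; apply: l2_ext => j; rewrite entry_amp// !entry_inj.
by case: eqP => // _; rewrite (lin0 bT.1).
Qed.

Lemma dot_amp_adjoint (T S : H -> H) u v : bounded_operator T ->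
  bounded_operator S -> adjoint T S -> dot (amp T u) v = dot u (amp S v).
Proof.
move=> bT bS TS; apply: dot_l2_lim.
have -> : (fun k => dot (entry k (amp T u)) (entry k v) : R[i]^o) =
          (fun k => dot (entry k u) (entry k (amp S v)) : R[i]^o).
  by apply/funext => k; rewrite !entry_amp// TS.
exact: dot_l2_cvg.
Qed.

Lemma big_ord_double (V : nmodType) (f : nat -> V) n :
  \sum_(k < n.*2) f k = \sum_(k < n) f k.*2 + \sum_(k < n) f k.*2.+1.
Proof.
elim: n => [|n IHn]; first by rewrite !big_ord0 addr0.
by rewrite doubleS !big_ord_recr /= IHn -!addrA; congr (_ + _); rewrite addrCA.
Qed.

Lemma interleave_subproof (u v : l2 H) :
  (fun k => if odd k then entry k./2 v else entry k./2 u) \in @l2_pred R H.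
Proof.
apply/l2_predP; exists (l2sq u + l2sq v) => n.
apply: (@le_trans _ _ (\sum_(k < n.*2)
    nrm (if odd k then entry k./2 v else entry k./2 u) ^+ 2)).
  rewrite -addnn big_split_ord /= lerDl.
  by apply: sumr_ge0 => k _; rewrite sqr_ge0.
rewrite (big_ord_double (fun k => nrm (if odd k then entry k./2 v else entry k./2 u) ^+ 2)).
apply: lerD.
  apply: le_trans (l2sq_ge u n); apply: ler_sum => k _.
  by rewrite odd_double doubleK.
apply: le_trans (l2sq_ge v n); apply: ler_sum => k _.
by rewrite /= odd_double /= uphalf_double.
Qed.

(** Sequences merged into one: a single sequence then controls the action of
an operator on both, which makes the ultrastrong seminorms a directed family.
*)
Definition interleave (u v : l2 H) : l2 H :=
  exist (fun w => w \in @l2_pred R H) _ (interleave_subproof u v).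

Lemma nrm_amp_interleave (T : H -> H) u v : bounded_operator T ->
  nrm (amp T u) <= nrm (amp T (interleave u v)) /\
  nrm (amp T v) <= nrm (amp T (interleave u v)).
Proof.
move=> bT.
have key n : \sum_(k < n) nrm (T (entry k u)) ^+ 2 + \sum_(k < n) nrm (T (entry k v)) ^+ 2
    <= l2sq (amp T (interleave u v)).
  apply: le_trans (l2sq_ge _ n.*2).
  rewrite (big_ord_double (fun k => nrm (entry k (amp T (interleave u v))) ^+ 2)).
  apply: lerD; apply: ler_sum => k _; rewrite entry_amp// {2}/entry /=.
    by rewrite odd_double doubleK.
  by rewrite odd_double /= uphalf_double.
have le_amp w : (forall n, \sum_(k < n) nrm (T (entry k w)) ^+ 2 <=
    l2sq (amp T (interleave u v))) -> nrm (amp T w) <= nrm (amp T (interleave u v)).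
  move=> hw; rewrite -(ler_pXn2r (n := 2)) ?nnegrE ?nrm_ge0// !nrm_l2_sq.
  apply: l2sq_le => n; apply: le_trans (hw n).
  by apply: ler_sum => k _; rewrite entry_amp.
split; apply: le_amp => n; apply: le_trans (key n).
  by rewrite lerDl sumr_ge0// => k _; rewrite sqr_ge0.
by rewrite lerDr sumr_ge0// => k _; rewrite sqr_ge0.
Qed.

End Amplification.

(** * Elements of a von Neumann algebra *)

Section Elements.
Variables (R : realType) (M : vnAlgebra R).
Local Notation H := (vn_space M).
Implicit Types (x y z : M) (u v w : H) (a : R[i]).

Lemma vn_bounded_operator x : bounded_operator (val x).
Proof. by have /vn_predP[] := valP x. Qed.

Lemma vn_linear x : linear (val x : H -> H).
Proof. by have [] := vn_bounded_operator x. Qed.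

Lemma vn_ext x y : (forall u, val x u = val y u) -> x = y.
Proof. by move=> h; apply/val_inj/funext. Qed.

Lemma vn_dot_ext x y : (forall u v, dot (val x u) v = dot (val y u) v) -> x = y.
Proof. by move=> h; apply: vn_ext => u; apply: dot_inj. Qed.

Lemma vnD x y u : val (x + y) u = val x u + val y u.
Proof. by []. Qed.

Lemma vnB x y u : val (x - y) u = val x u - val y u.
Proof. by []. Qed.

Lemma vnZ a x u : val (a *: x) u = a *: val x u.
Proof. by []. Qed.

Lemma vnM x y u : val (x * y) u = val x (val y u).
Proof. by []. Qed.

Lemma vn1 u : val (1 : M) u = u.
Proof. by []. Qed.

Lemma star_dot x u v : dot (val (star x) u) v = dot u (val x v).
Proof. by rewrite dotC -starP -dotC. Qed.

Lemma star_eq x y : adjoint (val x) (val y) -> star x = y.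
Proof.
move=> xy; apply: vn_dot_ext => u v.
by rewrite star_dot dotC xy -dotC.
Qed.

Lemma starK : involutive (@star R M).
Proof. by move=> x; apply: star_eq => u v; rewrite star_dot. Qed.

Lemma starM x y : star (x * y) = star y * star x.
Proof. by apply: star_eq => u v; rewrite !vnM -starP -starP. Qed.

(** The operator norm of [x] is at most [K]. *)
Definition op_le (K : R) x := forall u, nrm (val x u) <= K * nrm u.

Lemma op_le_exists x : exists2 K : R, 0 < K & op_le K x.
Proof.
have [lx cx] := vn_bounded_operator x.
by have [C C0 hC] := continuous_bounded lx cx; exists C.
Qed.

Lemma unit_ballP x : unit_ball x <-> op_le 1 x.
Proof.
by split=> h u; have := h u; rewrite !nrmE lecR mul1r.
Qed.

(** The square of [nrm (star x u)] is the inner product of [u] with [x (star x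
u)]. *)
Lemma op_le_star (K : R) x : op_le K x -> op_le K (star x).
Proof.
move=> hx u; have [->|p0] := eqVneq (nrm (val (star x) u)) 0.
  have [->|u0] := eqVneq u 0; first by rewrite nrm0 mulr0.
  have u1 := nrm_gt0 u0.
  by apply: le_trans (hx u); exact: nrm_ge0.
have p1 : 0 < nrm (val (star x) u) by rewrite lt_def p0 nrm_ge0.
rewrite -(ler_pM2r p1) -expr2 -rdot_nrm /rdot star_dot.
apply: le_trans (ler_norm _) (le_trans (ler_rdot _ _) _).
by rewrite mulrC [leRHS]mulrAC ler_wpM2r ?nrm_ge0.
Qed.

Lemma op_leM (K L : R) x y : 0 <= K -> op_le K x -> op_le L y ->
  op_le (K * L) (x * y).
Proof.
move=> K0 hx hy u; rewrite vnM; apply: le_trans (hx _) _.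
by rewrite -mulrA ler_wpM2l.
Qed.

Lemma op_leD (K L : R) x y : op_le K x -> op_le L y -> op_le (K + L) (x + y).
Proof.
move=> hx hy u; rewrite vnD mulrDl; apply: le_trans (ler_nrmD _ _) _.
exact: lerD.
Qed.

Lemma op_leW (K L : R) x : K <= L -> op_le K x -> op_le L x.
Proof. by move=> KL hx u; apply: le_trans (hx u) _; rewrite ler_wpM2r ?nrm_ge0. Qed.

Lemma op_le1 : op_le 1 (1 : M).
Proof. by move=> u; rewrite mul1r. Qed.

Lemma op_leZ (K t : R) x : op_le K x -> op_le (`|t| * K) (t%:C *: x).
Proof. by move=> hx u; rewrite vnZ nrmZr -mulrA ler_wpM2l. Qed.

Lemma op_leX x n : op_le 1 x -> op_le 1 (x ^+ n).
Proof.
move=> hx; elim: n => [|n IHn]; first by rewrite expr0; exact: op_le1.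
by rewrite exprS; have := op_leM ler01 hx IHn; rewrite mulr1.
Qed.

Lemma rdot_star_mul x u : rdot (val (star x * x) u) u = nrm (val x u) ^+ 2.
Proof. by rewrite /rdot vnM star_dot dot_nrm. Qed.

End Elements.

(** * Ultraweak and weak operator convergence *)

Lemma initial_cvgP (S : choiceType) (T : topologicalType) (g : S -> T) (x : S)
    (F : set_system S) : Filter F ->
  F --> (x : initial_topology g) <-> g @ F --> g x.
Proof.
move=> FF; split=> [h|h].
  exact: (continuous_cvg _ (@initial_continuous _ _ g x) h).
move=> A /= [_ [[B oB <-] Bx BA]].
have : nbhs (g x) B by rewrite nbhsE; exists B.
move=> /h; apply: (@filterS _ F FF (g @^-1` B) A) => t Bt.
exact: BA.
Qed.

Lemma ptws_cvgP (I : Type) (K : topologicalType) (F : set_system (I -> K))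
    (h : I -> K) : Filter F ->
  F --> (h : {ptws I -> K}) <-> forall i, g i @[g --> F] --> h i.
Proof.
move=> FF.
pose S := (forall i : I, (fun=> K) i) : choiceType.
have key i := @initial_cvgP S K (fun g => g i) h F FF.
rewrite cvg_sup; split=> Fh i.
  exact: (key i).1 (Fh i).
exact: (key i).2 (Fh i).
Qed.

Section Ultraweak.
Variables (R : realType) (M : vnAlgebra R).
Local Notation H := (vn_space M).

Lemma square_summableP (u : nat -> H) : @square_summable R M u <-> u \in @l2_pred R H.
Proof.
rewrite l2_cvgP; split=> /cvg_ex[l hl]; apply/cvg_ex.
  exists (complex.Re l); have /cvg_complex_seriesP[+ _] := hl.
  have -> // : (fun k => complex.Re (`|u k| ^+ 2)) = (fun k => nrm (u k) ^+ 2).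
  by apply/funext => k; rewrite nrmE -rmorphXn.
exists (l%:C : R[i]^o); apply/cvg_complex_seriesP; split=> /=.
  have -> // : (fun k => complex.Re (`|u k| ^+ 2)) = (fun k => nrm (u k) ^+ 2).
  by apply/funext => k; rewrite nrmE -rmorphXn.
rewrite (_ : series _ = cst 0); first exact: cvg_cst.
by apply/funext => n; rewrite seriesEnat /= big1// => k _; rewrite nrmE -rmorphXn.
Qed.

Definition l2_of (u : @square_summable R M) : l2 H :=
  exist (fun w => w \in @l2_pred R H) (set_val u)
    ((square_summableP (set_val u)).1 (set_mem (valP u))).

Definition of_l2 (u : l2 H) : @square_summable R M :=
  exist (fun w => w \in @square_summable R M) (val u)
    (mem_set ((square_summableP (val u)).2 (valP u))).

(** The functionals that define the ultraweak topology are the matrix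
coefficients of the amplification. *)
Lemma vector_functionalE (x : M) p :
  vector_functional x p = dot (amp (val x) (l2_of p.1)) (l2_of p.2).
Proof.
apply/esym; apply: dot_l2_lim; rewrite /vector_functional.
have -> : (fun k => dot (entry k (amp (val x) (l2_of p.1))) (entry k (l2_of p.2)) : R[i]^o)
  = (fun n => dot (val x (set_val p.1 n)) (set_val p.2 n) : R[i]^o).
  by apply/funext => k; rewrite entry_amp//; exact: vn_bounded_operator.
apply: dot_series_cvg.
  exact: (amp_subproof (l2_of p.1) (vn_bounded_operator x)).
exact: (valP (l2_of p.2)).
Qed.

Lemma dot_amp_functional (x : M) u v :
  dot (amp (val x) u) v = vector_functional x (of_l2 u, of_l2 v).
Proof.
by rewrite vector_functionalE; congr (dot (amp _ _) _); apply: l2_ext.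
Qed.

Lemma ultraweak_cvgP T (F : set_system T) {FF : Filter F} (f : T -> M) (x : M) :
  f @ F --> (x : ultraweak M) <->
  forall u v : l2 H, (dot (amp (val (f t)) u) v : R[i]^o) @[t --> F]
                  --> (dot (amp (val x) u) v : R[i]^o).
Proof.
pose vf := (@vector_functional R M) :
  M -> {ptws (@square_summable R M * @square_summable R M)%type -> R[i]^o}.
have e1 := initial_cvgP vf x (fmap_filter f FF).
have FF' : Filter (vf \o f @ F) by exact: fmap_filter.
have e2 := ptws_cvgP (vf x) FF'.
refine (iff_trans e1 (iff_trans e2 _)); split=> [h u v|h p].
  rewrite dot_amp_functional; apply: (@cvg_eq_fun _ R[i]^o F
    (fun t => vf (f t) (of_l2 u, of_l2 v))); last exact: h.
  by move=> t; rewrite dot_amp_functional.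
rewrite /vf vector_functionalE /=.
apply: (@cvg_eq_fun _ R[i]^o F
  (fun t => dot (amp (val (f t)) (l2_of p.1)) (l2_of p.2))); last exact: h.
by move=> t; rewrite /= vector_functionalE.
Qed.

(** Weak operator convergence; on bounded nets it agrees with ultraweak
convergence, and it can be checked one pair of vectors at a time. *)
Definition wcvg T (F : set_system T) (f : T -> M) (x : M) :=
  forall u v : H, (dot (val (f t) u) v : R[i]^o) @[t --> F]
               --> (dot (val x u) v : R[i]^o).

Lemma ultraweak_wcvg T (F : set_system T) {FF : Filter F} (f : T -> M) (x : M) :
  f @ F --> (x : ultraweak M) -> wcvg F f x.
Proof.
move=> /ultraweak_cvgP h u v.
have E (y : M) : dot (amp (val y) (l2inj 0 u)) (l2inj 0 v) = dot (val y u) v.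
  by rewrite amp_inj ?dot_injr ?entry_injE//; exact: vn_bounded_operator.
rewrite -E; apply: (@cvg_eq_fun _ R[i]^o F
  (fun t => dot (amp (val (f t)) (l2inj 0 u)) (l2inj 0 v))); last exact: h.
by move=> t; rewrite E.
Qed.

(** A bounded family sends the tail of [v] to uniformly small inner products;
what remains is a finite sum of matrix coefficients. *)
Lemma wcvg_ultraweak T (F : set_system T) {FF : Filter F} (f : T -> M) (x : M)
    (K : R) : 0 <= K ->
  (\forall t \near F, op_le K (f t)) -> op_le K x -> wcvg F f x ->
  f @ F --> (x : ultraweak M).
Proof.
move=> K0 fK xK fx; apply/ultraweak_cvgP => u v; apply/nrm_cvgP => e e0.
have bo y := vn_bounded_operator (y : M).
(* Two tails and the finite sum share [e] in equal parts. *)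
pose D := 3 * (K * nrm u + 1).
have KU0 : 0 < K * nrm u + 1 by rewrite ltr_wpDl// mulr_ge0// nrm_ge0.
have KU := lt0r_neq0 KU0.
have D0 : 0 < D by rewrite mulr_gt0.
have [n hn] := trunc_close v (divr_gt0 e0 D0).
have hT : (dot (amp (val (f t)) u) (trunc n v) : R[i]^o) @[t --> F]
                  --> (dot (amp (val x) u) (trunc n v) : R[i]^o).
  rewrite dot_trunc; under eq_cvg do rewrite dot_trunc.
  apply: cvg_big => [|k _]; first exact: add_continuous.
  by rewrite entry_amp//; under eq_cvg do rewrite entry_amp//; exact: fx.
have tail y : op_le K y ->
    nrm (dot (amp (val y) u) v - dot (amp (val y) u) (trunc n v) : R[i]^o) <= e / 3.
  move=> yK.
  have -> : (dot (amp (val y) u) v - dot (amp (val y) u) (trunc n v) : R[i]^o) =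
     dot (amp (val y) u) (v - trunc n v) by rewrite dotBr.
  apply: le_trans (ler_dot _ _) _.
  apply: (@le_trans _ _ ((K * nrm u + 1) * (e / D))).
    apply: ler_pM; rewrite ?nrm_ge0 ?(ltW hn)//.
    by apply: le_trans (nrm_amp _ (bo y) K0 yK) _; rewrite lerDl.
  rewrite le_eqVlt; apply/orP; left; apply/eqP; rewrite /D; field.
  exact: KU.
have e3 : 0 < e / 3 by rewrite divr_gt0.
have /nrm_cvgP/(_ _ e3) := hT; rewrite !near_map.
apply: filterS2 fK => t fKt ht.
apply: le_lt_trans (ler_nrm_dist (dot (amp (val x) u) (trunc n v) : R[i]^o) _ _) _.
apply: le_lt_trans (lerD (tail _ xK) (ler_nrm_dist
  (dot (amp (val (f t)) u) (trunc n v) : R[i]^o) _ _)) _.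
have htl := tail _ fKt; rewrite nrm_subC in htl.
rewrite [ltRHS](_ : e = e / 3 + (e / 3 + e / 3)); last by field.
by apply: ler_ltD => //; apply: ltr_leD.
Qed.

Lemma wcvg_unique T (F : set_system T) {FF : ProperFilter F} (f : T -> M) x y :
  wcvg F f x -> wcvg F f y -> x = y.
Proof.
move=> hx hy; apply: vn_dot_ext => u v.
exact: (@norm_cvg_unique _ R[i]^o _ _ _ _ (hx u v) (hy u v)).
Qed.

Lemma wcvg_cst T (F : set_system T) {FF : Filter F} (x : M) : wcvg F (fun=> x) x.
Proof. by move=> u v; exact: cvg_cst. Qed.

Lemma wcvg_mulr T (F : set_system T) {FF : Filter F} (f : T -> M) x b :
  wcvg F f x -> wcvg F (fun t => f t * b) (x * b).
Proof. by move=> h u v; have := h (val b u) v. Qed.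

Lemma wcvg_mull T (F : set_system T) {FF : Filter F} (f : T -> M) x b :
  wcvg F f x -> wcvg F (fun t => b * f t) (b * x).
Proof.
move=> h u v; rewrite vnM starP; apply: (@cvg_eq_fun _ R[i]^o F
  (fun t => dot (val (f t) u) (val (star b) v))); last exact: h.
by move=> t; rewrite vnM [RHS]starP.
Qed.

Lemma wcvg_near T (F : set_system T) {FF : Filter F} (f g : T -> M) x :
  (\forall t \near F, f t = g t) -> wcvg F f x -> wcvg F g x.
Proof.
move=> fg h u v; apply: cvg_trans (h u v); apply: near_eq_cvg.
by move: fg; apply: filterS => t ->.
Qed.

End Ultraweak.

(** * Ultrafilter limits of bounded families *)

Section Ultralimits.
Variable R : realType.

Lemma ultra_fmap T U (f : T -> U) (F : set_system T) :
  UltraFilter F -> UltraFilter (f @ F).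
Proof.
move=> FU; split; first exact: fmap_proper_filter.
move=> G GF sFG; rewrite predeqE => A; split; last exact: sFG.
move=> GA; have [//|FnA] := in_ultra_setVsetC (f @^-1` A) FU.
have : G (~` A) by exact: sFG.
by move=> /(filterI GA) /filter_ex[? []].
Qed.

Lemma ultra_cvg_bounded T (F : set_system T) (f : T -> R) (K : R) :
  UltraFilter F -> (\forall t \near F, `|f t| <= K) -> exists l : R, f @ F --> l.
Proof.
move=> FU fK; have := @segment_compact R (- K) K.
rewrite compact_ultra => /(_ _ (ultra_fmap f FU)) [|l [_ hl]]; last by exists l.
by move: fK; apply: filterS => t; rewrite /= in_itv/= -ler_norml.
Qed.

Lemma ultra_cvg_boundedC T (F : set_system T) (f : T -> R[i]^o) (K : R) :
  UltraFilter F -> (\forall t \near F, nrm (f t) <= K) -> exists l : R[i]^o, f @ F --> l.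
Proof.
move=> FU fK.
have [|p hp] := @ultra_cvg_bounded _ _ (fun t => complex.Re (f t)) K FU.
  by move: fK; apply: filterS => t; exact: le_trans (nrm_Re _).
have [|q hq] := @ultra_cvg_bounded _ _ (fun t => complex.Im (f t)) K FU.
  by move: fK; apply: filterS => t; exact: le_trans (nrm_Im _).
by exists ((p +i* q : R[i]) : R[i]^o); apply/cvg_complexP.
Qed.

Variable M : vnAlgebra R.
Local Notation H := (vn_space M).

(** The unit ball is weakly compact. The matrix coefficients converge because
they lie in compact discs, and the limit form is bounded, so it comes from an
operator. That operator commutes with every [g] of the commutant: the adjoint
of [g] moves [g] to the other side of the inner product. *)
Theorem op_le_ultralimit T (F : set_system T) (f : T -> M) (K : R) :
  UltraFilter F -> (\forall t \near F, op_le K (f t)) ->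
  exists2 x, op_le K x & wcvg F f x.
Proof.
move=> FU fK.
have fuv u v : \forall t \near F, nrm (dot (val (f t) u) v : R[i]^o) <= K * nrm u * nrm v.
  move: fK; apply: filterS => t h; apply: le_trans (ler_dot _ _) _.
  by rewrite ler_wpM2r ?nrm_ge0.
have /choice[B hB] (p : H * H) : exists l : R[i]^o,
    (dot (val (f t) p.1) p.2 : R[i]^o) @[t --> F] --> l.
  by have [l hl] := ultra_cvg_boundedC FU (fuv p.1 p.2); exists l.
have uniq u v (l : R[i]^o) : (dot (val (f t) u) v : R[i]^o) @[t --> F] --> l ->
    l = B (u, v).
  by move=> h; exact: (@norm_cvg_unique _ R[i]^o _ _ _ _ h (hB (u, v))).
have [|||S [lS bS hS]] := @form_operator R H (fun u v => B (u, v)) K.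
- move=> v a x y; apply/esym/uniq.
  apply: (@cvg_eq_fun _ R[i]^o F (fun t => a *: (dot (val (f t) x) v : R[i]^o)
      + dot (val (f t) y) v)).
    by move=> t; rewrite (vn_linear (f t)) dotDl dotZl.
  by apply: cvgD; [apply: cvgZl_tmp; exact: (hB (x, v))|exact: (hB (y, v))].
- move=> u a v w; apply/esym/uniq.
  apply: (@cvg_eq_fun _ R[i]^o F (fun t => a^*%C *: (dot (val (f t) u) v : R[i]^o)
      + dot (val (f t) u) w)).
    by move=> t; rewrite dotDr dotZr.
  by apply: cvgD; [apply: cvgZl_tmp; exact: (hB (u, v))|exact: (hB (u, w))].
- move=> u v; apply: (cvgr_to_le (cvg_nrm (hB (u, v)))).
  exact: fuv.
have cS : continuous S by exact: bounded_continuous bS.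
have MS : S \in @vn_pred R M.
  apply/vn_predP; split=> // g [bg cg].
  have [g' bg' gg'] := adjoint_exists bg.
  apply/funext => u; apply: dot_inj => v /=.
  rewrite hS gg' hS; apply/esym/uniq => /=.
  apply: (@cvg_eq_fun _ R[i]^o F (fun t => dot (val (f t) u) (g' v))).
    move=> t; rewrite -gg'.
    by have /(congr1 (@^~ u)) /= <- := cg _ (set_mem (valP (f t))).
  exact: (hB (u, g' v)).
by exists (exist (fun x => x \in @vn_pred R M) S MS) => // u v /=; rewrite hS; exact: (hB (u, v)).
Qed.

Lemma wcvg_sub T (F G : set_system T) (f : T -> M) x :
  F `<=` G -> wcvg F f x -> wcvg G f x.
Proof. by move=> FG h u v A /h /FG. Qed.

Lemma ultra_infty : exists2 F : set_system nat, UltraFilter F & \oo `<=` F.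
Proof. by have [F [? ?]] := ultraFilterLemma (@eventually_filter); exists F. Qed.

(** The sets of points where [f i t] is close to [x i] on a given sequence [u] form a
filter base, since two sequences can be interleaved into one.  Scaling [u] turns
the bound 1 into any other, and the Cauchy-Schwarz inequality in [l2 H] turns
closeness on [u] into closeness of the vector functionals.  A family indexed by
[I] is treated at once so that the limits are taken along the same filter. *)
Lemma strong_approx_ultraweak (N I : Type) (P : set N) (f : I -> N -> M)
    (x : I -> M) :
    (forall u : l2 H, exists2 t, P t &
      forall i, nrm (amp (val (f i t - x i)) u) <= 1) ->
  exists F : set_system N, [/\ UltraFilter F, F P &
    forall i, f i @ F --> (x i : ultraweak M)].
Proof.
move=> hu; pose B u := [set t | P t /\ forall i, nrm (amp (val (f i t - x i)) u) <= 1].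
have FB : ProperFilter (filter_from setT B).
  apply: filter_from_proper; last by move=> u _; have [t ? ?] := hu u; exists t.
  apply: filter_from_filter; first by exists 0.
  move=> u v _ _; exists (interleave u v); first by [].
  move=> t [Pt ht].
  have h i := @nrm_amp_interleave R H (val (f i t - x i)) u v (vn_bounded_operator _).
  split; split; [exact: Pt | move=> i | exact: Pt | move=> i].
    exact: le_trans (h i).1 (ht i).
  exact: le_trans (h i).2 (ht i).
have [F [FU sF]] := ultraFilterLemma FB; exists F; split=> //.
  by apply: sF; exists 0 => // t [].
move=> i; apply/ultraweak_cvgP => u v; apply/nrm_cvgP => e e0.
rewrite near_map; apply: sF.
pose s := (nrm v + 1) / e.
have s0 : 0 < s by rewrite divr_gt0// ltr_wpDl// nrm_ge0.
exists (s%:C *: u) => // t [_ /(_ i)].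
have bo y := vn_bounded_operator (y : M).
rewrite (linZ (amp_linear (bo _))) nrmZr (gtr0_norm s0) => ht /=.
have -> : (dot (amp (val (x i)) u) v - dot (amp (val (f i t)) u) v : R[i]^o) =
    - dot (amp (val (f i t - x i)) u) v.
  have -> : amp (val (f i t - x i)) u = amp (val (f i t)) u - amp (val (x i)) u.
    by apply: l2_ext => k; rewrite entryB !entry_amp.
  by rewrite dotBl opprB.
rewrite nrmN; apply: le_lt_trans (ler_dot _ _) _.
have h1 : nrm (amp (val (f i t - x i)) u) <= s^-1.
  by rewrite -[leRHS]mul1r ler_pdivlMr// mulrC.
apply: le_lt_trans (ler_wpM2r (nrm_ge0 _) h1) _.
rewrite /s invf_div mulrAC ltr_pdivrMr ?ltr_wpDl ?nrm_ge0//.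
by rewrite ltr_pM2l// ltrDl.
Qed.

End Ultralimits.

(** * Star-homomorphisms: contractivity and units of kernels *)

Section StarHom.
Variable R : realType.
Implicit Types M N : vnAlgebra R.

Section Basics.
Variables (M N : vnAlgebra R) (f : M -> N).
Hypothesis hf : star_hom f.

Lemma star_hom_linear : linear f. Proof. by have [] := hf. Qed.
Lemma star_hom1 : f 1 = 1. Proof. by have [_ [h _] _] := hf. Qed.
Lemma star_homM x y : f (x * y) = f x * f y.
Proof. by have [_ [_ h] _] := hf; rewrite h. Qed.
Lemma star_hom_star x : f (star x) = star (f x).
Proof. by have [_ _ h] := hf; rewrite h. Qed.
Lemma star_hom0 : f 0 = 0. Proof. exact: lin0 star_hom_linear. Qed.
Lemma star_homD x y : f (x + y) = f x + f y.
Proof. exact: linD star_hom_linear _ _. Qed.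
Lemma star_homB x y : f (x - y) = f x - f y.
Proof. exact: linB star_hom_linear _ _. Qed.
Lemma star_homZ a x : f (a *: x) = a *: f x.
Proof. exact: linZ star_hom_linear _ _. Qed.
Lemma star_homX x n : f (x ^+ n) = f x ^+ n.
Proof.
elim: n => [|n IHn]; first by rewrite !expr0 star_hom1.
by rewrite !exprS star_homM IHn.
Qed.
End Basics.

Lemma star_hom_inverse (N N' : vnAlgebra R) (f : N -> N') (g : N' -> N) :
  star_hom f -> cancel f g -> cancel g f -> star_hom g.
Proof.
move=> hf fg gf; split.
- move=> a x y; apply: (can_inj fg).
  by rewrite (star_homD hf) (star_homZ hf) !gf.
- split; first by apply: (can_inj fg); rewrite gf (star_hom1 hf).
  by move=> x y; apply: (can_inj fg); rewrite (star_homM hf) !gf.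
- by move=> x; apply: (can_inj fg); rewrite (star_hom_star hf) !gf.
Qed.

Lemma star_hom_comp (N1 N2 N3 : vnAlgebra R) (f : N2 -> N3) (g : N1 -> N2) :
  star_hom f -> star_hom g -> star_hom (f \o g).
Proof.
move=> hf hg; split.
- by move=> a x y /=; rewrite (star_homD hg) (star_homZ hg) (star_homD hf) (star_homZ hf).
- split; first by rewrite /= (star_hom1 hg) (star_hom1 hf).
  by move=> x y /=; rewrite (star_homM hg) (star_homM hf).
- by move=> x /=; rewrite (star_hom_star hg) (star_hom_star hf).
Qed.

Lemma star_hom_iter (N : vnAlgebra R) (f : N -> N) n :
  star_hom f -> star_hom (iter n f).
Proof.
move=> hf; elim: n => [|n IHn]; last exact: star_hom_comp.
by split=> //; split.
Qed.

(** The partial sums of the geometric series are bounded, so they have a weak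
limit, and they invert [1 - t a] up to a remainder tending to 0. *)
Lemma neumann M (a : M) (t : R) : 0 <= t < 1 -> op_le 1 a ->
  exists y : M, y * (1 - t%:C *: a) = 1.
Proof.
move=> /andP[t0 t1] a1; set b := t%:C *: a.
have bt n : op_le (t ^+ n) (b ^+ n).
  elim: n => [|n IHn]; first by rewrite !expr0; exact: op_le1.
  rewrite !exprS; apply: op_leM => //.
  by have := op_leZ t a1; rewrite ger0_norm// mulr1.
pose s n := \sum_(k < n) b ^+ k.
have sb n : s n * (1 - b) = 1 - b ^+ n.
  rewrite /s; elim: n => [|n IHn]; first by rewrite big_ord0 mul0r expr0 subrr.
  by rewrite big_ord_recr /= mulrDl IHn mulrBr mulr1 exprSr subrKA.
have sK n : op_le (1 - t)^-1 (s n).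
  have : op_le (\sum_(k < n) t ^+ k) (s n).
    rewrite /s; elim: n => [|n IHn]; last by rewrite !big_ord_recr; exact: op_leD.
    by rewrite !big_ord0 => u; rewrite mul0r nrm0.
  apply: op_leW; rewrite -[leRHS]mul1r ler_pdivlMr ?subr_gt0//.
  have -> : (\sum_(k < n) t ^+ k) * (1 - t) = 1 - t ^+ n.
    by rewrite -[LHS]opprK -mulrN opprB mulrC -subrX1 opprB.
  by rewrite gerBl exprn_ge0.
have [F FU sF] := ultra_infty.
have [|y _ hy] := @op_le_ultralimit R M _ F s (1 - t)^-1 FU; first exact: nearW.
exists y; have h1 : wcvg F (fun n => s n * (1 - b)) (y * (1 - b)) by exact: wcvg_mulr.
apply: (wcvg_unique h1).
apply: wcvg_sub sF _; apply: (@wcvg_near _ _ _ _ _ (fun n => 1 - b ^+ n)).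
  by apply: nearW => n; rewrite sb.
move=> u v; apply/nrm_cvgP => e e0; rewrite near_map.
have ht : nrm u * nrm v * t ^+ n @[n --> \oo] --> nrm u * nrm v * 0.
  by apply: cvgMr; apply: cvg_expr; rewrite ger0_norm.
rewrite mulr0 in ht.
have /cvgrPdist_lt/(_ _ e0) := ht; apply: filterS => n.
rewrite sub0r normrN ger0_norm ?mulr_ge0 ?nrm_ge0 ?exprn_ge0// => hn.
have -> : (dot (val (1 : M) u) v - dot (val (1 - b ^+ n) u) v : R[i]^o) =
    dot (val (b ^+ n) u) v.
  by rewrite -dotBl vnB opprB addrC subrK.
apply: le_lt_trans (ler_dot _ _) _; apply: le_lt_trans hn.
by rewrite mulrAC ler_wpM2r ?nrm_ge0// mulrC; exact: bt.
Qed.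

Lemma op_le1_star_mul M (x : M) : op_le 1 (star x * x) -> op_le 1 x.
Proof.
move=> h u; rewrite mul1r -(ler_pXn2r (n := 2))// ?nnegrE ?nrm_ge0//.
rewrite -rdot_star_mul; apply: le_trans (ler_norm _) (le_trans (ler_rdot _ _) _).
by rewrite expr2 ler_wpM2r ?nrm_ge0//; have := h u; rewrite mul1r.
Qed.

(** It suffices that [b = f (star x * x)] has norm at most 1. If its norm [l]
were larger than 1, then [1 - l ^- 2 b ^ 2] would be left invertible, being
the image of an element that the geometric series inverts. A left invertible
operator is bounded below, and for the self-adjoint [b] this contradicts that
[l] is the norm. *)
Lemma star_hom_contractive M N (f : M -> N) x :
  star_hom f -> op_le 1 x -> op_le 1 (f x).
Proof.
move=> hf x1; apply: op_le1_star_mul.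
rewrite -(star_hom_star hf) -(star_homM hf).
set a := star x * x.
have a1 : op_le 1 a by rewrite -[1](mulr1 1); apply: op_leM => //; exact: op_le_star.
have sa : star a = a by rewrite /a starM starK.
set b := f a; have sb : star b = b by rewrite /b -(star_hom_star hf) sa.
pose L := [set K : R | 0 <= K /\ op_le K b].
have iL : has_inf L.
  split; last by exists 0 => K [].
  by have [K K0 hK] := op_le_exists b; exists K; split=> //; exact: ltW.
pose l := inf L.
have Ll K : L K -> l <= K by apply: ge_inf; case: iL.
have l0 : 0 <= l by apply: lb_le_inf; [case: iL | move=> K []].
have lb : op_le l b.
  move=> u; apply/ler_addgt0Pr => e e0.
  have d0 : 0 < e / (nrm u + 1) by rewrite divr_gt0// ltr_wpDl// nrm_ge0.
  have [K [_ hK] Kl] := inf_adherent d0 iL.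
  apply: le_trans (hK u) _.
  apply: le_trans (ler_wpM2r (nrm_ge0 _) (ltW Kl)) _.
  rewrite mulrDl lerD2l mulrAC ler_pdivrMr ?ltr_wpDl ?nrm_ge0//.
  by rewrite ler_wpM2l ?(ltW e0)// lerDl.
have [l1|l1] := leP l 1; first exact: op_leW lb.
exfalso.
have lp : 0 < l by exact: lt_trans l1.
have t01 : 0 <= l ^- 2 < 1.
  by rewrite invr_ge0 sqr_ge0/= invf_lt1 ?exprn_gt0// exprn_egt1.
have a21 : op_le 1 (a * a) by rewrite -[1](mulr1 1); exact: op_leM.
have [y hy] := neumann t01 a21.
have {}hy : f y * (1 - (l ^- 2)%:C *: (b * b)) = 1.
  rewrite -[RHS](star_hom1 hf) -hy (star_homM hf) (star_homB hf) (star_homZ hf).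
  by rewrite (star_homM hf) (star_hom1 hf).
have [C C0 hC] := op_le_exists (f y).
have C2 : 0 < C ^+ 2 by rewrite exprn_gt0.
(* [C] bounds a left inverse of [1 - l ^- 2 b ^ 2]. *)
have main u : nrm (val b u) ^+ 2 <= l ^+ 2 * (1 - C ^- 2) * nrm u ^+ 2.
  have h1 : nrm u ^+ 2 <= C ^+ 2 * nrm (u - (l ^- 2)%:C *: val b (val b u)) ^+ 2.
    rewrite -exprMn ler_sqr ?nnegrE ?mulr_ge0 ?nrm_ge0 ?(ltW C0)//.
    have := congr1 (fun z : N => val z u) hy.
    by rewrite vnM vnB vn1 vnZ vnM => hu; rewrite -{1}hu; exact: hC.
  have h2 : rdot u (val b (val b u)) = nrm (val b u) ^+ 2.
    by rewrite -rdot_nrm /rdot -{3}sb star_dot.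
  have h3 : nrm (val b (val b u)) ^+ 2 <= l ^+ 2 * nrm (val b u) ^+ 2.
    by rewrite -exprMn ler_sqr ?nnegrE ?mulr_ge0 ?nrm_ge0//; exact: lb.
  move: h1; rewrite nrm_sqrB rdotZr h2 nrmZr exprMn real_normK ?num_real//.
  move: h3; move: (nrm u ^+ 2) (nrm (val b u) ^+ 2) (nrm (val b (val b u)) ^+ 2).
  move=> p q r h3 h1.
  have l2 : 0 < l ^+ 2 by rewrite exprn_gt0.
  have h4 : (l ^- 2) ^+ 2 * r <= l ^- 2 * q.
    rewrite expr2 -mulrA ler_pM2l ?invr_gt0// mulrC ler_pdivrMr//.
    by rewrite mulrC.
  have h5 : p <= C ^+ 2 * (p - l ^- 2 * q).
    by apply: le_trans h1 _; rewrite ler_pM2l//; lra.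
  have h6 : C ^- 2 * p <= p - l ^- 2 * q by rewrite mulrC ler_pdivrMr// mulrC.
  have h7 : l ^- 2 * q <= (1 - C ^- 2) * p by rewrite mulrBl mul1r; lra.
  by move: h7; rewrite mulrC ler_pdivrMr// mulrC mulrA.
(* The square root of [mu] is a bound for [b] smaller than [l]. *)
pose mu := l ^+ 2 * (1 - C ^- 2).
have Lmu : L (Num.sqrt mu).
  split; first exact: sqrtr_ge0.
  move=> u; have [mu0|mu0] := leP 0 mu.
    rewrite -(ler_pXn2r (n := 2))// ?nnegrE ?mulr_ge0 ?sqrtr_ge0 ?nrm_ge0//.
    by rewrite exprMn sqr_sqrtr//; exact: main.
  have : nrm (val b u) ^+ 2 <= 0.
    apply: le_trans (main u) _; rewrite -/mu.
    by rewrite nmulr_rle0 ?sqr_ge0.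
  rewrite le_eqVlt ltNge sqr_ge0 orbF sqrf_eq0 => /eqP ->.
  by rewrite mulr_ge0 ?sqrtr_ge0 ?nrm_ge0.
have := Ll _ Lmu; apply/negP; rewrite -ltNge.
rewrite -(ltr_pXn2r (n := 2))// ?nnegrE ?sqrtr_ge0//.
have l2 : 0 < l ^+ 2 by rewrite exprn_gt0.
have [mu0|mu0] := leP 0 mu; last by rewrite ler0_sqrtr ?(ltW mu0)// expr0n.
rewrite sqr_sqrtr// /mu -[ltRHS]mulr1 ltr_pM2l// gtrBl invr_gt0//.
Qed.

Lemma normal_cvg M N (f : M -> N) T (F : set_system T) {FF : Filter F}
    (g : T -> M) (x : M) :
  normal f -> g @ F --> (x : ultraweak M) -> wcvg F (f \o g) (f x).
Proof.
move=> nf gx; apply: ultraweak_wcvg; exact: (cvg_comp _ _ gx (nf x)).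
Qed.

Lemma normal_wcvg M N (f : M -> N) T (F : set_system T) {FF : Filter F}
    (g : T -> M) (x : M) (K : R) :
  normal f -> 0 <= K -> (\forall t \near F, op_le K (g t)) ->
  op_le K x -> wcvg F g x -> wcvg F (f \o g) (f x).
Proof.
by move=> nf K0 gK xK gx; apply: normal_cvg => //; exact: (wcvg_ultraweak K0 gK xK gx).
Qed.

Section KernelUnit.
Variables (M N : vnAlgebra R) (f : M -> N).
Hypotheses (hf : star_hom f) (nf : normal f).

(** With [T = 1 - c (star x * x)] for a small [c], the elements [1 - T ^+ n]
lie in the kernel of [f], since [f T = 1]. The squared norms of [T ^+ n u]
decrease, and their consecutive differences dominate [c] times the squared
norms of [x (T ^+ n u)], which therefore tend to 0; so every weak limit of [1
- T ^+ n] is a right unit for [x]. *)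
Lemma kernel_local_unit x : f x = 0 ->
  exists e, [/\ f e = 0, op_le 2 e & x * e = x].
Proof.
move=> fx; have [C C0 hC] := op_le_exists (star x).
have C2 : 0 < C ^+ 2 by rewrite exprn_gt0.
pose c := C ^- 2; have c0 : 0 < c by rewrite invr_gt0.
pose T : M := 1 - c%:C *: (star x * x).
have fT : f T = 1.
  by rewrite /T (star_homB hf) (star_homZ hf) (star_homM hf) fx mulr0 scaler0
    subr0 (star_hom1 hf).
have decr u : c * nrm (val x u) ^+ 2 <= nrm u ^+ 2 - nrm (val T u) ^+ 2.
  rewrite /T vnB vn1 vnZ nrm_sqrB rdotZr rdotC rdot_star_mul nrmZr exprMn.
  rewrite real_normK ?num_real//.
  have : c ^+ 2 * nrm (val (star x * x) u) ^+ 2 <= c * nrm (val x u) ^+ 2.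
    rewrite expr2 -mulrA ler_pM2l// mulrC ler_pdivrMr// mulrC -exprMn.
    by rewrite ler_sqr ?nnegrE ?mulr_ge0 ?nrm_ge0 ?(ltW C0)//; exact: hC.
  by move: (nrm _ ^+ 2) (nrm _ ^+ 2) (c ^+ 2 * _) => p q r; lra.
have T1 : op_le 1 T.
  move=> u; rewrite mul1r -(ler_pXn2r (n := 2))// ?nnegrE ?nrm_ge0//.
  rewrite -subr_ge0; apply: le_trans (decr u).
  by rewrite mulr_ge0 ?sqr_ge0// ltW.
pose s n : M := 1 - T ^+ n.
have fs n : f (s n) = 0.
  by rewrite /s (star_homB hf) (star_homX hf) fT expr1n (star_hom1 hf) subrr.
have s2 n : op_le 2 (s n).
  rewrite /s -scaleN1r; apply: op_leD; first exact: op_le1.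
  have := @op_leZ _ _ 1 (-1) _ (op_leX n T1).
  by rewrite normrN1 mulr1 rmorphN rmorph1.
have [F FU sF] := ultra_infty.
have [|e e2 he] := @op_le_ultralimit R M _ F s 2 FU; first exact: nearW.
exists e; split=> //.
  have h1 : wcvg F (f \o s) (f e).
    by apply: (normal_wcvg nf (ler0n _ 2) _ e2 he); exact: nearW.
  apply: (wcvg_unique h1).
  apply: wcvg_near (@wcvg_cst _ _ _ F _ 0).
  by apply: nearW => n /=; rewrite fs.
have h1 : wcvg F (fun n => x * s n) (x * e) by exact: wcvg_mull.
apply: (wcvg_unique h1).
apply: wcvg_sub sF _ => u v; apply/nrm_cvgP => d d0; rewrite near_map.
pose q n := nrm (val (T ^+ n) u) ^+ 2.
have qcv : cvgn q.
  apply: nonincreasing_is_cvgn.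
    apply/nonincreasing_seqP => n; rewrite /q [T ^+ n.+1]exprS vnM.
    rewrite -subr_ge0; apply: le_trans (decr _).
    by rewrite mulr_ge0 ?sqr_ge0// ltW.
  by exists 0 => _ [n _ <-]; rewrite /q sqr_ge0.
have q0 : q n - q n.+1 @[n --> \oo] --> (0 : R).
  rewrite -(subrr (limn q)); apply: cvgB => //.
  by have := qcv; rewrite -(cvg_shiftS q).
pose D := c * (d / (nrm v + 1)) ^+ 2.
have v1 : 0 < nrm v + 1 by rewrite ltr_wpDl ?nrm_ge0.
have D0 : 0 < D by rewrite mulr_gt0// exprn_gt0// divr_gt0.
have /cvgrPdist_lt/(_ _ D0) := q0; apply: filterS => n.
rewrite sub0r normrN => /(le_lt_trans (ler_norm _)) hq.
have -> : (dot (val x u) v - dot (val (x * s n) u) v : R[i]^o) =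
   dot (val x (val (T ^+ n) u)) v.
  rewrite -dotBl vnM /s vnB vn1 (linB (vn_linear x)).
  by rewrite opprB addrC subrK.
apply: le_lt_trans (ler_dot _ _) _.
have h : nrm (val x (val (T ^+ n) u)) < d / (nrm v + 1).
  rewrite -(ltr_pXn2r (n := 2))// ?nnegrE ?nrm_ge0 ?ltW ?divr_gt0//.
  rewrite -(ltr_pM2l c0); apply: le_lt_trans (decr _) _.
  by rewrite -vnM -[T * _]exprS.
apply: le_lt_trans (ler_wpM2r (nrm_ge0 _) (ltW h)) _.
by rewrite mulrAC ltr_pdivrMr// ltr_pM2l// ltrDl.
Qed.

(** A right unit for [star x * x + star y * y] is a right unit for [x] and for
[y]. Hence the sets of bounded right units of single elements form a filter
base, and a weak limit along it is a right unit for all of them. *)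
Lemma kernel_right_unit : exists e, f e = 0 /\ forall x, f x = 0 -> x * e = x.
Proof.
pose U (x : M) := [set e : M | [/\ f e = 0, op_le 2 e & x * e = x]].
have FB : ProperFilter (filter_from [set x | f x = 0] U).
  apply: filter_from_proper; last by move=> x /kernel_local_unit[e he]; exists e.
  apply: filter_from_filter; first by exists 0; exact: star_hom0.
  move=> x y fx fy; exists (star x * x + star y * y).
    by rewrite /= (star_homD hf) !(star_homM hf) fx fy !mulr0 addr0.
  move=> e [fe e2 he].
  have key u : nrm (val x (u - val e u)) ^+ 2 + nrm (val y (u - val e u)) ^+ 2 = 0.
    rewrite -!rdot_star_mul -rdotDl -vnD (linB (vn_linear _)) -vnM he subrr.
    by rewrite /rdot dot0l.
  have zero (z : M) : (forall u, nrm (val z (u - val e u)) ^+ 2 = 0) -> z * e = z.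
    move=> hz; apply: vn_ext => u; apply/esym/subr0_eq; rewrite vnM.
    rewrite -(linB (vn_linear z)); apply/nrm_eq0/eqP.
    by rewrite -sqrf_eq0 hz.
  split; split=> //; apply: zero => u; apply/eqP.
    have := key u; move/eqP; rewrite paddr_eq0 ?sqr_ge0// => /andP[]//.
  have := key u; move/eqP; rewrite paddr_eq0 ?sqr_ge0// => /andP[]//.
have [F [FU sF]] := ultraFilterLemma FB.
have F0 : \forall e \near F, f e = 0 /\ op_le 2 e.
  by apply: sF; exists 0; [exact: star_hom0 | move=> e []].
have F2 : \forall e \near F, op_le 2 (id e) by move: F0; apply: filterS => e [].
have [e e2 he] := op_le_ultralimit FU F2.
exists e; split.
  have h1 : wcvg F (f \o id) (f e) by exact: normal_wcvg (ler0n _ 2) F2 e2 he.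
  apply: (wcvg_unique h1).
  apply: wcvg_near (@wcvg_cst _ _ _ F _ 0).
  by move: F0; apply: filterS => t [/= ->].
move=> x fx; have h1 : wcvg F (fun t => x * t) (x * e) by exact: wcvg_mull.
apply: (wcvg_unique h1).
apply: wcvg_near (@wcvg_cst _ _ _ F _ x).
by apply: sF; exists x => // t [].
Qed.

End KernelUnit.
End StarHom.

(** * The density theorem *)

Section Density.
Variables (R : realType) (H : hilbertType R).

(** The truncations of a sequence are finite sums of vectors from single
summands. *)
Lemma l2_total (V : normedModType R[i]) (f : l2 H -> V) (C : R) : linear f ->
  (forall u, nrm (f u) <= C * nrm u) -> (forall k h, f (l2inj k h) = 0) ->
  forall u, f u = 0.
Proof.
move=> lf bf f0 u; apply/nrm_eq0/eqP; rewrite eq_le nrm_ge0 andbT.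
apply/ler_addgt0Pr => e e0; rewrite add0r.
have C1 : 0 < `|C| + 1 by rewrite ltr_wpDl.
have [n hn] := trunc_close u (divr_gt0 e0 C1).
have ft : f (trunc n u) = 0.
  rewrite /trunc; elim: n {hn} => [|n IHn]; first by rewrite big_ord0 (lin0 lf).
  by rewrite big_ord_recr/= (linD lf) IHn f0 addr0.
rewrite -[u](subrK (trunc n u)) (linD lf) ft addr0.
apply: le_trans (bf _) _; move: hn; rewrite ltr_pdivlMr// => /ltW; apply: le_trans.
rewrite mulrC ler_wpM2l ?nrm_ge0//.
by apply: le_trans (ler_norm _) _; rewrite lerDl.
Qed.

(** The projection [P] onto the closure of [C], the orbit of [w] under the amplified
algebra, commutes with the amplified algebra, so the entries of its matrix lie in
the commutant of [A].  An operator [T] of the bicommutant commutes with these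
entries, hence its amplification commutes with [P] and maps [w], which lies in
[C], into the closure of [C]. *)
Theorem bicommutant_density (A : set (H -> H)) :
    A `<=` bounded_operator (H := H) -> A id ->
    (forall a f g, A f -> A g -> A (a *: f + g)) ->
    (forall f g, A f -> A g -> A (f \o g)) ->
    (forall f, A f -> exists2 g, A g & adjoint f g) ->
  forall T, commutant (commutant A) T -> forall w : l2 H,
    exists2 f, A f & nrm (amp f w - amp T w) <= 1.
Proof.
move=> bA A1 AD AM Astar T [bT cT] w.
pose C := [set amp f w | f in A].
have A0 : A (0 : H -> H) by have := AD (-1) _ _ A1 A1; rewrite scaleN1r addNr.
have C0 : C 0.
  exists 0 => //; apply: l2_ext => k; rewrite entry_amp//; exact: bA.
have lC a c d : C c -> C d -> C (a *: c + d).
  move=> [f Af <-] [g Ag <-]; exists (a *: f + g); first exact: AD.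
  apply: l2_ext => k; rewrite entryD entryZ !entry_amp//; try exact: bA.
  by apply: bA; exact: AD.
have [P [lP bP clP oP]] := orthogonal_projection C0 lC.
have uniqP x y : closure C y -> (forall c, C c -> dot (x - y) c = 0) -> P x = y.
  move=> cy oy; apply/subr0_eq; apply: (@closure_orthogonal_eq0 _ _ C).
    apply/closure_nrmP => e e0; have e2 : 0 < e / 2 by rewrite divr_gt0.
    have /closure_nrmP/(_ _ e2)[c Cc hc] := clP x.
    have /closure_nrmP/(_ _ e2)[d Cd hd] := cy.
    exists (c - d); first by rewrite addrC -scaleN1r; exact: lC.
    rewrite opprD addrACA -opprD (splitr e); apply: le_lt_trans (ler_nrmD _ _) _.
    by rewrite ltrD// nrmN.
  move=> c Cc; have -> : P x - y = (x - y) - (x - P x).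
    by rewrite opprB [RHS]addrC subrKA.
  by rewrite dotBl oy// oP// subr0.
have ampP f : A f -> forall v, P (amp f v) = amp f (P v).
  move=> Af v; have [K K0 hK] := continuous_bounded (bA _ Af).1 (bA _ Af).2.
  have laf := amp_linear (bA _ Af).
  apply: uniqP.
    apply/closure_nrmP => e e0.
    have /closure_nrmP/(_ _ (divr_gt0 e0 K0))[_ [g Ag <-] hg] := clP v.
    exists (amp f (amp g w)).
      exists (f \o g); first exact: AM.
      apply: l2_ext => k; rewrite !entry_amp//; try exact: bA.
      by apply: bA; exact: AM.
    rewrite -(linB laf); apply: le_lt_trans (nrm_amp _ (bA _ Af) (ltW K0) hK) _.
    by rewrite mulrC -ltr_pdivlMr.
  move=> _ [g Ag <-]; have [f' Af' ff'] := Astar _ Af.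
  rewrite -(linB laf) (dot_amp_adjoint _ _ (bA _ Af) (bA _ Af') ff').
  apply: oP; exists (f' \o g); first exact: AM.
  apply: l2_ext => k; rewrite !entry_amp//; try exact: bA.
  by apply: bA; exact: AM.
have lT := amp_linear bT.
have [K K0 hK] := continuous_bounded bT.1 bT.2.
have TP v : amp T (P v) = P (amp T v).
  apply/subr0_eq; move: v.
  apply: (@l2_total _ (fun v => amp T (P v) - P (amp T v)) (K + K)).
  - move=> a x y; rewrite lP (lT a) lT lP scalerBr opprD.
    by rewrite addrACA.
  - move=> u; rewrite mulrDl; apply: le_trans (ler_nrmD _ _) _; rewrite nrmN.
    apply: lerD.
      apply: le_trans (nrm_amp _ bT (ltW K0) hK) _.
      by rewrite ler_pM2l//; exact: bP.
    exact: le_trans (bP _) (nrm_amp _ bT (ltW K0) hK).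
  move=> j h; apply/eqP; rewrite subr_eq0; apply/eqP; apply: l2_ext => i.
  rewrite entry_amp// amp_inj//.
  have Pij : commutant A (fun h => entry i (P (l2inj j h))).
    have lij : linear (fun h => entry i (P (l2inj j h))).
      by move=> a x y; rewrite l2inj_linear lP entryD entryZ.
    split; first split=> //.
      apply: (bounded_continuous (C := 1) lij) => x; rewrite mul1r.
      apply: le_trans (nrm_entry _ _) (le_trans (bP _) _).
      by rewrite nrm_inj.
    move=> f Af; apply/funext => x /=.
    by rewrite -amp_inj ?ampP ?entry_amp//; exact: bA.
  exact: (congr1 (@^~ h) (cT _ Pij)).
have Cw : C w by exists id => //; apply: l2_ext => k; rewrite entry_amp//; exact: bA.
have Pw : P w = w.
  apply: uniqP; first exact: subset_closure.
  by move=> c _; rewrite subrr dot0l.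
have /closure_nrmP/(_ _ ltr01)[_ [f Af <-] hf] : closure C (amp T w).
  by rewrite -Pw TP.
by exists f => //; rewrite nrm_subC ltW.
Qed.

End Density.

(** * The von Neumann algebra of bounded backward orbits *)

Section InverseLimit.
Variables (R : realType) (M : vnAlgebra R) (alpha : M -> M).
Hypotheses (ha : star_hom alpha) (na : normal alpha).
Local Notation H := (vn_space M).
Implicit Types (x : nat -> M).

Definition backward_orbit x :=
  (exists C : R, forall k, op_le C (x k)) /\ (forall k, alpha (x k.+1) = x k).

(** The operator acting on the [k]-th summand by [x k]; the default value
stands for sequences that are not square-summable. *)
Definition diag x (u : l2 H) : l2 H :=
  insubd (0 : l2 H) (fun k => val (x k) (entry k u)).

Lemma diag_subproof x (C : R) u : (forall k, op_le C (x k)) ->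
  (fun k => val (x k) (entry k u)) \in @l2_pred R H.
Proof.
move=> hC; apply/l2_predP; exists (C ^+ 2 * l2sq u) => n.
apply: le_trans (ler_wpM2l _ (l2sq_ge u n)); last by rewrite sqr_ge0.
rewrite mulr_sumr; apply: ler_sum => k _; rewrite -exprMn.
rewrite ler_sqr ?nnegrE ?nrm_ge0 ?(le_trans (nrm_ge0 _) (hC k _))//.
exact: hC.
Qed.

Lemma entry_diag x k u : (exists C : R, forall k, op_le C (x k)) ->
  entry k (diag x u) = val (x k) (entry k u).
Proof. by move=> [C hC]; rewrite /diag /entry val_insubd (diag_subproof u hC). Qed.

Lemma diag_linear x : (exists C : R, forall k, op_le C (x k)) -> linear (diag x).
Proof.
move=> bx a u v; apply: l2_ext => k.
by rewrite entryD entryZ !entry_diag// entryD entryZ vn_linear.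
Qed.

Lemma nrm_diag x (C : R) u : (forall k, op_le C (x k)) ->
  nrm (diag x u) <= C * nrm u.
Proof.
move=> hC; have [u0|u0] := eqVneq u 0.
  by rewrite u0 (lin0 (diag_linear _)) ?nrm0 ?mulr0//; exists C.
have u1 := nrm_gt0 u0.
have [C0|C0] := leP 0 C; last first.
  exfalso; move/negP: u0; apply; apply/eqP/l2_ext => k.
  have := le_trans (nrm_ge0 _) (hC k (entry k u)).
  rewrite nmulr_rge0// => h; apply/nrm_eq0/eqP.
  by rewrite eq_le nrm_ge0 andbT.
rewrite -(ler_pXn2r (n := 2))// ?nnegrE ?mulr_ge0 ?nrm_ge0// exprMn !nrm_l2_sq.
apply: l2sq_le => n; apply: le_trans (ler_wpM2l _ (l2sq_ge u n)); last by rewrite sqr_ge0.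
rewrite mulr_sumr; apply: ler_sum => k _; rewrite -exprMn entry_diag; last by exists C.
by rewrite ler_sqr ?nnegrE ?nrm_ge0 ?mulr_ge0 ?nrm_ge0//; exact: hC.
Qed.

Lemma diag_bounded_operator x : (exists C : R, forall k, op_le C (x k)) ->
  bounded_operator (diag x).
Proof.
move=> bx; have lx := diag_linear bx; split=> //; have [C hC] := bx.
exact: (bounded_continuous lx (fun u => nrm_diag u hC)).
Qed.

Definition orbit_operators : set (l2 H -> l2 H) :=
  [set diag x | x in backward_orbit].

Lemma orbit_operators_bounded : orbit_operators `<=` bounded_operator (H := l2 H).
Proof. by move=> _ [x [bx _] <-]; exact: diag_bounded_operator. Qed.

Lemma orbit_operators_id : orbit_operators id.
Proof.
exists (fun=> 1).
  by split; [exists 1 => _; exact: op_le1 | move=> _; exact: star_hom1].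
by apply/funext => u; apply: l2_ext => k; rewrite entry_diag//; exists 1 => _; exact: op_le1.
Qed.

Lemma orbit_operators_lin a f g : orbit_operators f -> orbit_operators g ->
  orbit_operators (a *: f + g).
Proof.
move=> [x [bx ax] <-] [y [by_ ay] <-].
have bxy : exists C : R, forall k, op_le C (a *: x k + y k).
  have [C hC] := bx; have [D hD] := by_; exists (complex.Re `|a| * C + D) => k.
  apply: op_leD => // u; rewrite vnZ nrmZ -mulrA ler_wpM2l//; last exact: hC.
  by rewrite -ler0c RRe_real ?normr_ge0// realE normr_ge0.
exists (fun k => a *: x k + y k).
  by split=> // k; rewrite (star_homD ha) (star_homZ ha) ax ay.
apply/funext => u; apply: l2_ext => k; rewrite entry_diag//.
by rewrite -[RHS]/(a *: entry k (diag x u) + entry k (diag y u)) !entry_diag.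
Qed.

Lemma orbit_operators_comp f g : orbit_operators f -> orbit_operators g ->
  orbit_operators (f \o g).
Proof.
move=> [x [bx ax] <-] [y [by_ ay] <-].
have bxy : exists C : R, forall k, op_le C (x k * y k).
  have [C hC] := bx; have [D hD] := by_; exists (`|C| * D) => k.
  by apply: op_leM => //; apply: op_leW (hC k); exact: ler_norm.
exists (fun k => x k * y k).
  by split=> // k; rewrite (star_homM ha) ax ay.
by apply/funext => u; apply: l2_ext => k; rewrite /= !entry_diag.
Qed.

Lemma orbit_operators_adjoint f : orbit_operators f ->
  exists2 g, orbit_operators g & adjoint f g.
Proof.
move=> [x [bx ax] <-].
have bs : exists C : R, forall k, op_le C (star (x k)).
  by have [C hC] := bx; exists C => k; exact: op_le_star.
exists (diag (fun k => star (x k))).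
  by exists (fun k => star (x k)) => //; split=> // k; rewrite (star_hom_star ha) ax.
move=> u v; apply: dot_l2_lim.
have -> : (fun k => dot (entry k (diag x u)) (entry k v) : R[i]^o) =
   (fun k => dot (entry k u) (entry k (diag (fun k => star (x k)) v)) : R[i]^o).
  by apply/funext => k; rewrite !entry_diag// starP.
exact: dot_l2_cvg.
Qed.

Lemma lift_entry_subproof k (u : l2 H) :
  (fun n => l2inj k (entry n u)) \in @l2_pred R (l2 H).
Proof.
apply/l2_predP; exists (l2sq u) => n; apply: le_trans (l2sq_ge u n).
by apply: ler_sum => i _; rewrite nrm_inj.
Qed.

(** Amplifying an operator on [l2 H] and applying it to this sequence recovers
the action of its [k]-th diagonal entry on [u]. *)
Definition lift_entry k (u : l2 H) : l2 (l2 H) :=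
  exist (fun w => w \in @l2_pred R (l2 H)) _ (lift_entry_subproof k u).

Lemma entry_lift_entry n k u : entry n (lift_entry k u) = l2inj k (entry n u).
Proof. by []. Qed.

Lemma nrm_amp_lift_entry (T : l2 H -> l2 H) (S : H -> H) k u :
  bounded_operator T -> bounded_operator S ->
  (forall h, entry k (T (l2inj k h)) = S h) ->
  nrm (amp S u) <= nrm (amp T (lift_entry k u)).
Proof.
move=> bT bS TS.
rewrite -(ler_pXn2r (n := 2))// ?nnegrE ?nrm_ge0// !nrm_l2_sq.
apply: l2sq_le => n; apply: le_trans (l2sq_ge _ n); apply: ler_sum => i _.
rewrite !entry_amp// entry_lift_entry -TS.
by rewrite ler_sqr ?nnegrE ?nrm_ge0// nrm_entry.
Qed.

(** An operator [T] of the bicommutant commutes with the operators acting by a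
single [S] of the commutant of [M] on one summand. For [S = id] this makes [T]
diagonal; for general [S] it puts the entries of [T] into [M]. The relation
between two consecutive entries is not expressed by commutation: it passes to
the limit from the orbits that approximate [T] by the density theorem. *)
Lemma orbit_operators_bicommutant :
  commutant (commutant orbit_operators) = orbit_operators.
Proof.
apply/seteqP; split=> [T hT|f hf]; last first.
  split; first exact: orbit_operators_bounded.
  by move=> g [_ hg]; rewrite hg.
have [bT cT] := hT.
have [C C0 hC] := continuous_bounded bT.1 bT.2.
have entry_comm k (S : H -> H) : commutant (vn_set M) S ->
    forall u, T (l2inj k (S (entry k u))) = l2inj k (S (entry k (T u))).
  move=> [bS cS] u.
  have [D D0 hD] := continuous_bounded bS.1 bS.2.
  have lS : linear (fun u : l2 H => l2inj k (S (entry k u))).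
    by move=> a v w; rewrite entryD entryZ bS.1 l2inj_linear.
  have comS : commutant orbit_operators (fun u => l2inj k (S (entry k u))).
    split; first split=> //.
      apply: (bounded_continuous (C := D) lS) => v; rewrite nrm_inj.
      by apply: le_trans (hD _) _; rewrite ler_pM2l// nrm_entry.
    move=> _ [x [bx _] <-]; apply/funext => v; apply: l2_ext => j /=.
    rewrite !entry_diag// !entry_inj; case: eqP => [->|_].
      exact: (congr1 (@^~ (entry k v)) (cS _ (set_mem (valP (x k))))).
    by rewrite (lin0 (vn_linear (x j))).
  exact: (congr1 (@^~ u) (cT _ comS)).
pose Tk k h := entry k (T (l2inj k h)).
have idM : commutant (vn_set M) id.
  by split=> //; split=> // x; exact: cvg_id.
have TE k u : entry k (T u) = Tk k (entry k u).
  by have := congr1 (entry k) (entry_comm k id idM u); rewrite entry_injE => <-.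
have lTk k : linear (Tk k).
  by move=> a u v; rewrite /Tk l2inj_linear bT.1 entryD entryZ.
have bTk k h : nrm (Tk k h) <= C * nrm h.
  by apply: le_trans (nrm_entry _ _) _; apply: le_trans (hC _) _; rewrite nrm_inj.
have MT k : Tk k \in @vn_pred R M.
  apply/vn_predP; split; first by split=> //; exact: bounded_continuous (bTk k).
  move=> S cS; apply/funext => h /=.
  have := congr1 (entry k) (entry_comm k S cS (l2inj k h)).
  by rewrite !entry_injE.
pose x k : M := exist (fun f : H -> H => f \in @vn_pred R M) (Tk k) (MT k).
have xC k : op_le C (x k) by move=> h; exact: bTk.
exists x; last first.
  by apply/funext => u; apply: l2_ext => k; rewrite entry_diag ?TE//; exists C.
split; first by exists C.
move=> k.
pose f (b : bool) (y : nat -> M) : M := if b then y k.+1 else y k.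
have [u|F [FU FP hF]] := @strong_approx_ultraweak R M (nat -> M) bool
    backward_orbit f (fun b => if b then x k.+1 else x k).
  (* One sequence that controls the entries of index [k] and [k.+1] together. *)
  pose w := interleave (lift_entry k u) (lift_entry k.+1 u).
  have [_ [y oy <-] hy] := bicommutant_density orbit_operators_bounded
    orbit_operators_id orbit_operators_lin orbit_operators_comp
    orbit_operators_adjoint hT w.
  exists y => // b; have [by_ _] := oy.
  have bd := diag_bounded_operator by_.
  have bdT : bounded_operator (diag y - T).
    have ld : linear (diag y - T : l2 H -> l2 H).
      move=> a s t; rewrite -![(diag y - T) _]/(diag y _ - T _) bd.1 bT.1 scalerBr.
      by rewrite opprD addrACA.
    have [D hD] := by_.
    split=> //; apply: (bounded_continuous (C := D + C) ld) => s.
    rewrite -![(diag y - T) _]/(diag y _ - T _) mulrDl.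
    apply: le_trans (ler_nrmD _ _) _; rewrite nrmN.
    by apply: lerD; [exact: nrm_diag | exact: hC].
  have ampB : amp (diag y - T) w = amp (diag y) w - amp T w.
    by apply: l2_ext => n; rewrite entryB !entry_amp.
  rewrite -ampB in hy.
  have [h1 h2] := nrm_amp_interleave (lift_entry k u) (lift_entry k.+1 u) bdT.
  have TS j h : entry j ((diag y - T) (l2inj j h)) = val (y j - x j) h.
    by rewrite -[(diag y - T) _]/(diag y _ - T _) entryB entry_diag// entry_injE.
  case: b; apply: le_trans hy.
    apply: le_trans h2; apply: nrm_amp_lift_entry => //.
    exact: vn_bounded_operator.
  apply: le_trans h1; apply: nrm_amp_lift_entry => //.
  exact: vn_bounded_operator.
have h1 : wcvg F (alpha \o f true) (alpha (x k.+1)).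
  exact: (normal_cvg na (hF true)).
apply: (wcvg_unique h1).
apply: wcvg_near (ultraweak_wcvg (hF false)).
by move: FP; apply: filterS => y [_ ay] /=; rewrite ay.
Qed.

Definition inverse_limit : vnAlgebra R :=
  @VnAlgebra R (l2 H) orbit_operators orbit_operators_adjoint
    orbit_operators_bicommutant.

Lemma orbit_exists (y : inverse_limit) :
  exists x, backward_orbit x /\ val y = diag x.
Proof.
have : vn_set inverse_limit (val y) := set_mem (valP y).
by move=> [x bx e]; exists x.
Qed.

(** The diagonal entries of an element; they are unique by [orbit_val]. *)
Definition orbit (y : inverse_limit) : nat -> M := projT1 (cid (orbit_exists y)).

Lemma orbitP (y : inverse_limit) : backward_orbit (orbit y).
Proof. by have [] := projT2 (cid (orbit_exists y)). Qed.

Lemma orbitE (y : inverse_limit) : val y = diag (orbit y).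
Proof. by have [] := projT2 (cid (orbit_exists y)). Qed.

Definition of_orbit x (bx : backward_orbit x) : inverse_limit :=
  exist (fun f : l2 H -> l2 H => f \in @vn_pred R inverse_limit) (diag x)
    (mem_set (ex_intro2 _ _ x bx erefl)).

Lemma entry_val (y : inverse_limit) k u :
  entry k (val y u) = val (orbit y k) (entry k u).
Proof. by rewrite orbitE entry_diag//; have [] := orbitP y. Qed.

Lemma orbit_val (y : inverse_limit) k h :
  val (orbit y k) h = entry k (val y (l2inj k h)).
Proof. by rewrite entry_val entry_injE. Qed.

Lemma of_orbitK x (bx : backward_orbit x) k : orbit (of_orbit bx) k = x k.
Proof.
apply: vn_ext => h; rewrite orbit_val /= entry_diag ?entry_injE//.
by case: bx.
Qed.

Lemma orbit_inj (y z : inverse_limit) : (forall k, orbit y k = orbit z k) -> y = z.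
Proof.
move=> h; apply: vn_ext => u; apply: l2_ext => k.
by rewrite !entry_val h.
Qed.

Lemma orbit_hom k : star_hom (fun y : inverse_limit => orbit y k).
Proof.
split.
- by move=> a y z; apply: vn_ext => h; rewrite vnD vnZ !orbit_val vnD vnZ entryD entryZ.
- split; first by apply: vn_ext => h; rewrite orbit_val !vn1 entry_injE.
  by move=> y z; apply: vn_ext => h; rewrite orbit_val vnM entry_val -orbit_val.
- move=> y; apply/esym/star_eq => u v.
  rewrite !orbit_val; apply: (etrans (esym (dot_injr _ _ _))).
  apply: (etrans (starP y (l2inj k u) (l2inj k v))); exact: dot_injl.
Qed.

Lemma orbit_normal k : normal (fun y : inverse_limit => orbit y k).
Proof.
move=> y.
have h : id @ nbhs (y : ultraweak inverse_limit) --> (y : ultraweak inverse_limit)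
  by exact: cvg_id.
have FF := nbhs_filter (y : ultraweak inverse_limit).
apply: (@ultraweak_cvgP R M _ _ FF (fun y : inverse_limit => orbit y k) _).2 => u v.
have key (z : inverse_limit) : dot (amp (val (orbit z k)) u) v =
    dot (amp (val z) (lift_entry k u)) (lift_entry k v).
  apply: dot_l2_lim.
  have -> : (fun n => dot (entry n (amp (val (orbit z k)) u)) (entry n v) : R[i]^o) =
    (fun n => dot (entry n (amp (val z) (lift_entry k u)))
      (entry n (lift_entry k v)) : R[i]^o).
    apply/funext => n; rewrite !entry_amp; try exact: vn_bounded_operator.
    by rewrite orbit_val !entry_lift_entry dot_injr.
  exact: dot_l2_cvg.
rewrite key; apply: (@cvg_eq_fun _ R[i]^o _
  (fun z : inverse_limit => dot (amp (val z) (lift_entry k u)) (lift_entry k v))).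
  by move=> z; rewrite key.
exact: (ultraweak_cvgP id y).1 h _ _.
Qed.

(** This sequence is also the image of [x] under [alpha] applied to all
entries. *)
Lemma forward_orbit x : backward_orbit x ->
  backward_orbit (fun k => if k is j.+1 then x j else alpha (x 0%N)).
Proof.
move=> [[C hC] ax]; split; last by case.
have [D D0 hD] := op_le_exists (alpha (x 0%N)).
exists (`|C| + D) => -[|k].
  by apply: op_leW hD; rewrite lerDr.
by apply: op_leW (hC k); apply: le_trans (ler_norm _) _; rewrite lerDl ltW.
Qed.

Lemma shift_orbit x : backward_orbit x -> backward_orbit (fun k => x k.+1).
Proof. by move=> [[C hC] ax]; split=> //; exists C. Qed.

Definition limit_aut (y : inverse_limit) := of_orbit (forward_orbit (orbitP y)).
Definition limit_autV (y : inverse_limit) := of_orbit (shift_orbit (orbitP y)).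

Lemma limit_aut_hom : star_hom limit_aut.
Proof.
have h k := orbit_hom k.
split.
- move=> a y z; apply: orbit_inj => k.
  rewrite (star_homD (h k)) (star_homZ (h k)) !of_orbitK; case: k => [|k].
    by rewrite (star_homD (h _)) (star_homZ (h _)) (star_homD ha) (star_homZ ha).
  by rewrite (star_homD (h _)) (star_homZ (h _)).
- split.
    apply: orbit_inj => k; rewrite (star_hom1 (h k)) of_orbitK.
    by case: k => [|k]; rewrite (star_hom1 (h _)) ?(star_hom1 ha).
  move=> y z; apply: orbit_inj => k.
  rewrite (star_homM (h k)) !of_orbitK; case: k => [|k].
    by rewrite (star_homM (h _)) (star_homM ha).
  by rewrite (star_homM (h _)).
- move=> y; apply: orbit_inj => k.
  rewrite (star_hom_star (h k)) !of_orbitK; case: k => [|k].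
    by rewrite (star_hom_star (h _)) (star_hom_star ha).
  by rewrite (star_hom_star (h _)).
Qed.

Lemma limit_autK : cancel limit_aut limit_autV.
Proof. by move=> y; apply: orbit_inj => k; rewrite !of_orbitK. Qed.

Lemma limit_autVK : cancel limit_autV limit_aut.
Proof.
move=> y; apply: orbit_inj => k; rewrite of_orbitK; case: k => [|k].
  by rewrite of_orbitK; have [_ ->] := orbitP y.
by rewrite of_orbitK.
Qed.

Lemma limit_comm :
  (fun y : inverse_limit => orbit y 0%N) \o limit_aut =
  alpha \o (fun y : inverse_limit => orbit y 0%N).
Proof. by apply/funext => y /=; rewrite of_orbitK. Qed.

Definition limit_lifting : lifting alpha :=
  Lifting limit_aut_hom limit_autK limit_autVK (orbit_hom 0) (orbit_normal (k := 0%N))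
    limit_comm.

Lemma orbit_iter_autV n k (y : inverse_limit) : orbit (iter n limit_autV y) k = orbit y (n + k).
Proof.
elim: n k => // n IHn k; rewrite iterS of_orbitK IHn.
by rewrite addSn addnS.
Qed.

Lemma limit_nondegenerate : nondegenerate_lifting limit_lifting.
Proof.
move=> y h; apply: orbit_inj => -[|k].
  by have /= -> := h 0; rewrite (star_hom0 (orbit_hom _)).
have := h (Negz k); rewrite /=.
have := orbit_iter_autV k.+1 0 y; rewrite addn0 => <-.
by rewrite (star_hom0 (orbit_hom _)).
Qed.

Lemma iter_orbit n (y : inverse_limit) : iter n alpha (orbit y n) = orbit y 0%N.
Proof.
elim: n => // n IHn; rewrite iterSr; have [_ ->] := orbitP y; exact: IHn.
Qed.

Lemma orbit_op_le (y : inverse_limit) (C : R) k : op_le C y -> op_le C (orbit y k).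
Proof.
move=> hC h; rewrite orbit_val; apply: le_trans (nrm_entry _ _) _.
by apply: le_trans (hC _) _; rewrite nrm_inj.
Qed.

(** The limits along an ultrafilter of the sequences [n |-> alpha^(n - k) (a n)], for
each [k], form a backward orbit. *)
Lemma ball_orbit_exists (rho : M -> R[i]^o) (c : R) : normal_functional rho ->
  (forall n, exists2 a, op_le 1 a & c < nrm (rho (iter n alpha a))) ->
  exists2 y : inverse_limit, op_le 1 y & c <= nrm (rho (orbit y 0%N)).
Proof.
move=> [_ cr] hc.
have /choice[a ha'] n : exists a, op_le 1 a /\ c < nrm (rho (iter n alpha a)).
  by have [a ? ?] := hc n; exists a.
have ia n b : op_le 1 b -> op_le 1 (iter n alpha b).
  exact: star_hom_contractive (star_hom_iter n ha).
(* Only large [n] matter for a given [k], so the truncated difference is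
   harmless. *)
pose g k n := iter (n - k) alpha (a n).
have g1 k n : op_le 1 (g k n) by apply: ia; have [] := ha' n.
have [F FU sF] := ultra_infty.
have /choice[y hy] k : exists y, op_le 1 y /\ wcvg F (g k) y.
  have [|y y1 hy] := @op_le_ultralimit R M _ F (g k) 1 FU; first exact: nearW.
  by exists y.
have oy : backward_orbit y.
  split; first by exists 1 => k; have [] := hy k.
  move=> k; have [yk1 hk1] := hy k.+1; have [yk hk] := hy k.
  have h1 : wcvg F (alpha \o g k.+1) (alpha (y k.+1)).
    by apply: (normal_wcvg na ler01 _ yk1 hk1); exact: nearW.
  apply: (wcvg_unique h1); apply: wcvg_near hk.
  apply: sF; exists k.+1 => // n /= kn.
  by rewrite /g -iterS -subSn// subSS.
exists (of_orbit oy).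
  by move=> u; apply: nrm_diag => k; have [] := hy k.
rewrite of_orbitK; have [y0 hy0] := hy 0%N.
have h0 : g 0%N @ F --> (y 0%N : ultraweak M).
  by apply: wcvg_ultraweak ler01 _ y0 hy0; exact: nearW.
have h1 : rho \o g 0%N @ F --> rho (y 0%N) by exact: (cvg_comp _ _ h0 (cr _)).
apply: (cvgr_to_ge (cvg_nrm h1)); apply: nearW => n.
by rewrite /= /g subn0 ltW//; have [] := ha' n.
Qed.

(** The norms decrease to their infimum. They are at least the norm for the
lifting, as the entry of index 0 is the image under [alpha^n] of the entry of
index [n], and by [ball_orbit_exists] the latter norm is at least any number
below the infimum. *)
Lemma limit_norm (rho : M -> R[i]^o) : normal_functional rho ->
  (fun n => functional_norm (rho \o iter n alpha)) @ \oo -->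
  functional_norm (rho \o @lift_map R M alpha limit_lifting).
Proof.
move=> hr; pose s n := functional_norm (rho \o iter n alpha).
pose t := functional_norm (rho \o @lift_map R M alpha limit_lifting).
have ubs n a : op_le 1 a -> ((nrm (rho (iter n alpha a)))%:E <= s n)%E.
  by move=> a1; apply: ereal_sup_ubound; exists a => //; apply/unit_ballP.
have ts n : (t <= s n)%E.
  apply: ge_ereal_sup => _ [y /unit_ballP y1 <-] /=.
  by rewrite -(iter_orbit n); apply: ubs; exact: orbit_op_le.
have s_decr : nonincreasing_seq s.
  apply/nonincreasing_seqP => n; apply: ge_ereal_sup => _ [a /unit_ballP a1 <-].
  by rewrite /= -iterS iterSr; apply: ubs; exact: star_hom_contractive a1.
have := ereal_nonincreasing_cvgn s_decr.
suff -> : ereal_inf (range s) = t by [].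
apply/eqP; rewrite eq_le; apply/andP; split; last first.
  by apply: le_ereal_inf_tmp => _ [n _ <-].
have step (c : R) : (c%:E < ereal_inf (range s))%E -> (c%:E <= t)%E.
  move=> hc; have [|y y1 hy] := @ball_orbit_exists rho c hr.
    move=> n; have : (c%:E < s n)%E.
      by apply: lt_le_trans hc _; apply: ereal_inf_lbound; exists n.
    case/ereal_sup_gt => _ [a /unit_ballP a1 <-]; rewrite lte_fin => h.
    by exists a.
  apply: (@le_trans _ _ (nrm (rho (orbit y 0%N)))%:E); first by rewrite lee_fin.
  by apply: ereal_sup_ubound; exists y => //; apply/unit_ballP.
have t0 : (0 <= t)%E.
  apply: (@le_trans _ _ (nrm (rho (orbit 0 0%N)))%:E); first by rewrite lee_fin nrm_ge0.
  apply: ereal_sup_ubound; exists 0 => //; apply/unit_ballP => u.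
  by rewrite mul1r nrm0 nrm_ge0.
case: (t) t0 step => [r _ step|_ _|//]; last by rewrite leey.
case: (ereal_inf _) step => [i step|step|_]; last by rewrite leNye.
  rewrite lee_fin leNgt; apply/negP => ri.
  have := step ((r + i) / 2); rewrite lte_fin lee_fin.
  by move=> h; have := h ltac:(lra); lra.
have := step (r + 1); rewrite ltry lee_fin => /(_ isT).
by rewrite gerDl leNgt ltr01.
Qed.

Theorem asymptotic_lift_exists : exists L : lifting alpha, asymptotic_lift L.
Proof.
exists limit_lifting; split; [exact: limit_nondegenerate|exact: limit_norm].
Qed.

End InverseLimit.

(** * Separation by normal functionals *)

Section Separation.
Variable R : realType.
Implicit Types M N : vnAlgebra R.

Lemma unimodular (z : R[i]) :
  exists2 c : R[i], complex.Re `|c| = 1 & nrm (z : R[i]^o) = complex.Re (c * z).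
Proof.
have [->|z0] := eqVneq z 0.
  by exists 1; rewrite ?normr1// mulr0 nrm0.
have nz0 : `|z| != 0 by rewrite normr_eq0.
exists (z^*%C / `|z|).
  by rewrite normrM normcJ normfV normr_id divff.
rewrite mulrAC [_^*%C * z]mulrC -sqr_normc expr2 mulfK//.
Qed.

Lemma normal_functional_amp M (u v : l2 (vn_space M)) :
  normal_functional (fun x : M => dot (amp (val x) u) v : R[i]^o).
Proof.
have bo (y : M) := vn_bounded_operator y.
split=> [a x y|x].
  have -> : amp (val (a *: x + y)) u = a *: amp (val x) u + amp (val y) u;
    last by rewrite dotDl dotZl.
  by apply: l2_ext => k; rewrite entryD entryZ !entry_amp.
have h : id @ nbhs (x : ultraweak M) --> (x : ultraweak M) by exact: cvg_id.
exact: (ultraweak_cvgP id x).1 h u v.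
Qed.

(** If [x] were approximable on every square-summable sequence by images of
contractions, then a weak limit of those contractions would be mapped to [x].
So there is a sequence [u] on which the convex set [C] of these images stays
at distance more than 1 from [X]; the vector [v] from the point of the closure
of [C] nearest to [X] separates, and its matrix coefficient with [u] is the
functional [rho]. *)
Lemma unit_ball_image_separation N M (f : N -> M) (x : M) :
    star_hom f -> normal f -> (forall w, op_le 1 w -> f w <> x) ->
  exists2 rho : M -> R[i]^o, normal_functional rho &
    exists2 d : R, 0 < d & forall w, op_le 1 w ->
      nrm (rho (f w)) <= nrm (rho x) - d.
Proof.
move=> hf nf fx.
have bo (y : M) := vn_bounded_operator y.
have ampB (y z : M) u : amp (val (y - z)) u = amp (val y) u - amp (val z) u.
  by apply: l2_ext => k; rewrite entryB !entry_amp.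
have [u hu] : exists u : l2 (vn_space M), forall w, op_le 1 w ->
    1 < nrm (amp (val (f w - x)) u).
  apply: contrapT => hn.
  have [|F [FU FP Fx]] := @strong_approx_ultraweak R M N unit
      [set w | op_le 1 w] (fun=> f) (fun=> x).
    move=> u; apply: contrapT => hw; apply: hn; exists u => w w1.
    by rewrite ltNge; apply/negP => h; apply: hw; exists w.
  have [y y1 hy] := @op_le_ultralimit R N _ F id 1 FU FP.
  apply: (fx y y1).
  have h1 : wcvg F (f \o id) (f y) by exact: normal_wcvg ler01 FP y1 hy.
  apply: (wcvg_unique h1).
  exact: ultraweak_wcvg (Fx tt).
pose C := [set amp (val (f w)) u | w in [set w | op_le 1 w]].
pose X := amp (val x) u.
have [||c0 c0C hc0] := @nearest_point R _ C X.
- by exists (amp (val (f 1)) u), 1 => //=; exact: op_le1.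
- move=> _ _ t /andP[t0 t1] [w w1 <-] [z z1 <-].
  exists (w + t%:C *: (z - w)).
    move=> h; rewrite vnD vnZ vnB.
    have -> : val w h + t%:C *: (val z h - val w h) =
        (1 - t)%:C *: val w h + t%:C *: val z h.
      by rewrite rmorphB rmorph1 scalerBr scalerBl scale1r addrA addrAC.
    apply: le_trans (ler_nrmD _ _) _.
    rewrite !nrmZr ger0_norm ?subr_ge0// ger0_norm// mul1r.
    have := w1 h; have := z1 h; rewrite !mul1r.
    by move: (nrm _) (nrm _) (nrm _) => p q r; nra.
  rewrite (star_homD hf) (star_homZ hf) (star_homB hf).
  apply: l2_ext => k; rewrite entryD entryZ entryB !entry_amp//.
set v := X - c0 in hc0.
have v0 : 0 < nrm v.
  rewrite lt_def nrm_ge0 andbT; apply/eqP => /nrm_eq0 /subr0_eq e.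
  have /closure_nrmP/(_ _ ltr01)[_ [w w1 <-]] := c0C.
  by rewrite -e nrm_subC -ampB => /(lt_trans (hu w w1)); rewrite ltxx.
have [rl rc] := normal_functional_amp u v.
exists (fun y : M => dot (amp (val y) u) v : R[i]^o) => //.
exists (nrm v ^+ 2); first by rewrite exprn_gt0.
move=> w w1.
(* Rotating [w] by a unimodular scalar makes its value real and nonnegative. *)
have [c c1 hc] := unimodular (dot (amp (val (f w)) u) v).
have cw1 : op_le 1 (c *: w) by move=> h; rewrite vnZ nrmZ c1 mul1r; exact: w1.
apply: (@le_trans _ _ (rdot X v - nrm v ^+ 2)); last first.
  by rewrite lerD2r; exact: le_trans (ler_norm _) (nrm_Re _).
have -> : nrm (dot (amp (val (f w)) u) v : R[i]^o) = rdot (amp (val (f (c *: w))) u) v.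
  by rewrite hc (star_homZ hf) /rdot; congr complex.Re; exact/esym/(linZ rl c (f w)).
move: cw1; move: (c *: w) => {c c1 hc} {w1}w w1.
have /hc0 : C (amp (val (f w)) u) by exists w.
rewrite rdotBr (rdotC v) (rdotC v c0).
have e : nrm v ^+ 2 = rdot X v - rdot c0 v by rewrite -rdot_nrm {1}/v rdotBl.
rewrite e subr_le0 => h.
by rewrite opprB addrC subrK.
Qed.

End Separation.

(** * Uniqueness of asymptotic lifts *)

Section Uniqueness.
Variables (R : realType) (M : vnAlgebra R) (alpha : M -> M).
Implicit Types L : lifting alpha.

Local Notation aut L := (@lift_aut R M alpha L).
Local Notation autV L := (@lift_autV R M alpha L).
Local Notation E L := (@lift_map R M alpha L).

Lemma autV_hom L : star_hom (autV L).
Proof.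
exact: star_hom_inverse (@lift_aut_hom _ _ _ L) (@lift_autK _ _ _ L)
  (@lift_autVK _ _ _ L).
Qed.

Lemma map_iter_aut L n y : E L (iter n (aut L) y) = iter n alpha (E L y).
Proof.
elim: n => //= n IHn; rewrite -IHn.
exact: (congr1 (@^~ (iter n (aut L) y)) (@lift_comm _ _ _ L)).
Qed.

Lemma iter_autK L n y : iter n (autV L) (iter n (aut L) y) = y.
Proof. by elim: n y => // n IHn y; rewrite iterSr /= lift_autK IHn. Qed.

Lemma iter_autVK L n y : iter n (aut L) (iter n (autV L) y) = y.
Proof. by elim: n y => // n IHn y; rewrite iterSr /= lift_autVK IHn. Qed.

(** Since [E \o aut = alpha \o E], the coordinates with nonpositive index
determine the others. *)
Lemma nondegenerate_backward L : nondegenerate_lifting L ->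
  forall x y, (forall n, E L (iter n (autV L) x) = E L (iter n (autV L) y)) -> x = y.
Proof.
move=> nd x y h; apply/subr0_eq; apply: nd => -[k|k] /=.
  have hE := @lift_map_hom _ _ _ L.
  have hb := star_hom_iter k (@lift_aut_hom _ _ _ L).
  rewrite (star_homB hb) (star_homB hE) !map_iter_aut.
  by have /= -> := h 0%N; rewrite subrr.
have hE := @lift_map_hom _ _ _ L.
have hb := star_hom_iter k.+1 (autV_hom L).
have := star_homB hb x y => /= ->.
by rewrite (star_homB hE); have /= -> := h k.+1; rewrite subrr.
Qed.

(** The asymptotic condition determines the norm of [rho \o E L] for every
normal [rho], hence no normal functional separates a point of one image from
the other. *)
Lemma asymptotic_ball_image L1 L2 (y : lift_alg L1) :
  asymptotic_lift L1 -> asymptotic_lift L2 -> op_le 1 y ->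
  exists2 w : lift_alg L2, op_le 1 w & E L2 w = E L1 y.
Proof.
move=> [_ as1] [_ as2] y1; apply: contrapT => hn.
have [|rho nrho [d d0 hd]] := @unit_ball_image_separation R _ _ (E L2) (E L1 y)
  (@lift_map_hom _ _ _ L2) (@lift_map_normal _ _ _ L2).
  by move=> w w1 ew; apply: hn; exists w.
have e12 : functional_norm (rho \o E L1) = functional_norm (rho \o E L2).
  exact: (cvg_unique (@ereal_hausdorff R) (as1 rho nrho) (as2 rho nrho)).
have h2 : (functional_norm (rho \o E L2) <= (nrm (rho (E L1 y)) - d)%:E)%E.
  apply: ge_ereal_sup => _ [w /unit_ballP w1 <-]; rewrite lee_fin; exact: hd.
have h1 : ((nrm (rho (E L1 y)))%:E <= functional_norm (rho \o E L1))%E.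
  by apply: ereal_sup_ubound; exists y => //; apply/unit_ballP.
have := le_trans h1; rewrite e12 => /(_ _ h2).
by rewrite lee_fin lerBrDr gerDl leNgt d0.
Qed.

(** The elements [w n] match the coordinates of [y] up to index [n]. Modulo
the kernel of [E L2 \o beta2^-n], which has the right unit [q n], the sequence
is constant from [n] on, so its weak limit matches all the coordinates. *)
Lemma transfer_exists L1 L2 (y : lift_alg L1) :
  asymptotic_lift L1 -> asymptotic_lift L2 ->
  exists w : lift_alg L2,
    forall n, E L2 (iter n (autV L2) w) = E L1 (iter n (autV L1) y).
Proof.
move=> as1 as2.
wlog y1 : y / op_le 1 y.
  move=> h; have [K K0 hK] := op_le_exists y.
  have hV n := star_hom_iter n (autV_hom L1).
  have hW n := star_hom_iter n (autV_hom L2).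
  have [|w hw] := h (K^-1%:C *: y).
    have := op_leZ K^-1 hK; rewrite ger0_norm ?invr_ge0 ?(ltW K0)//.
    by rewrite mulVf// gt_eqF.
  exists (K%:C *: w) => n.
  rewrite (star_homZ (hW n)) (star_homZ (@lift_map_hom _ _ _ L2)) hw.
  rewrite (star_homZ (hV n)) (star_homZ (@lift_map_hom _ _ _ L1)) scalerA.
  by rewrite -rmorphM/= divff ?gt_eqF// scale1r.
have hV n := star_hom_iter n (autV_hom L1).
have hW n := star_hom_iter n (autV_hom L2).
have hB n := star_hom_iter n (@lift_aut_hom _ _ _ L2).
have hE := @lift_map_hom _ _ _ L2.
have /choice[z hz] n : exists z : lift_alg L2,
    op_le 1 z /\ E L2 z = E L1 (iter n (autV L1) y).
  have [z ? ?] := asymptotic_ball_image as1 as2 (star_hom_contractive (hV n) y1).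
  by exists z.
pose w n := iter n (aut L2) (z n).
have w1 n : op_le 1 (w n) by apply: (star_hom_contractive (hB n)); exact: (hz n).1.
have [e [Ee he]] := kernel_right_unit hE (@lift_map_normal _ _ _ L2).
have coherent n m : (n <= m)%N ->
    E L2 (iter n (autV L2) (w m)) = E L1 (iter n (autV L1) y).
  move=> nm; rewrite /w -(subnKC nm) iterD iter_autK map_iter_aut (hz _).2.
  rewrite addnC iterD -map_iter_aut.
  by rewrite iter_autVK.
(* [q n] is a right unit of the kernel of [E L2 \o iter n (autV L2)]. *)
pose q n := iter n (aut L2) e.
have abs n x : E L2 (iter n (autV L2) x) = 0 -> x * q n = x.
  move=> h; have := he _ h => /(congr1 (iter n (aut L2))).
  by rewrite (star_homM (hB n)) iter_autVK.
have [F FU sF] := ultra_infty.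
have [|l l1 hl] := @op_le_ultralimit R _ _ F w 1 FU; first exact: nearW.
exists l => n.
have key : l * (1 - q n) = w n * (1 - q n).
  have h1 : wcvg F (fun m => w m * (1 - q n)) (l * (1 - q n)) by exact: wcvg_mulr.
  apply: (wcvg_unique h1); apply: wcvg_near (@wcvg_cst _ _ _ F _ (w n * (1 - q n))).
  apply: sF; exists n => // m /= nm.
  apply/subr0_eq; rewrite -mulrBl mulrBr mulr1 abs ?subrr//.
  by rewrite (star_homB (hW n)) (star_homB hE) !coherent// subrr.
rewrite -(coherent n n (leqnn n)); apply/subr0_eq.
rewrite -(star_homB hE) -(star_homB (hW n)).
have -> : l - w n = (l - w n) * q n.
  apply/subr0_eq; rewrite -[X in X - _]mulr1 -mulrBr mulrBl key subrr//.
by rewrite (star_homM (hW n)) iter_autK (star_homM hE) Ee mulr0.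
Qed.

Theorem asymptotic_lift_unique L1 L2 :
  asymptotic_lift L1 -> asymptotic_lift L2 -> isomorphic_liftings L1 L2.
Proof.
move=> as1 as2; have [nd1 _] := as1; have [nd2 _] := as2.
have /choice[g hg] y := transfer_exists y as1 as2.
have /choice[h hh] y := transfer_exists y as2 as1.
have i2 := nondegenerate_backward nd2; have i1 := nondegenerate_backward nd1.
have hV n := star_hom_iter n (autV_hom L1).
have hW n := star_hom_iter n (autV_hom L2).
have hE1 := @lift_map_hom _ _ _ L1; have hE2 := @lift_map_hom _ _ _ L2.
exists g; split.
- split.
  + move=> a x y; apply: i2 => n; rewrite hg.
    rewrite (star_homD (hW n)) (star_homZ (hW n)) (star_homD hE2) (star_homZ hE2) !hg.
    by rewrite (star_homD (hV n)) (star_homZ (hV n)) (star_homD hE1) (star_homZ hE1).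
  + split.
      apply: i2 => n; rewrite hg (star_hom1 (hW n)) (star_hom1 (hV n)).
      by rewrite (star_hom1 hE1) (star_hom1 hE2).
    move=> x y; apply: i2 => n; rewrite hg.
    rewrite (star_homM (hW n)) (star_homM hE2) !hg.
    by rewrite (star_homM (hV n)) (star_homM hE1).
  + move=> x; apply: i2 => n; rewrite hg.
    rewrite (star_hom_star (hW n)) (star_hom_star hE2) !hg.
    by rewrite (star_hom_star (hV n)) (star_hom_star hE1).
- exists h => y; [apply: i1 => n|apply: i2 => n]; first by rewrite hh hg.
  by rewrite hg hh.
- apply/funext => y /=; apply: i2 => -[|n]; rewrite hg /=.
    have := map_iter_aut 1 (g y); rewrite /= => ->.
    have := map_iter_aut 1 y; rewrite /= => ->.
    by have /= -> := hg y 0%N.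
  have e1 := iterSr n (autV L1) (aut L1 y); have e2 := iterSr n (autV L2) (aut L2 (g y)).
  by rewrite /= in e1 e2; rewrite e1 e2 !lift_autK hg.
- by apply/funext => y /=; have /= := hg y 0%N.
Qed.

End Uniqueness.

Theorem theorem2p6 (R : realType) (M : vnAlgebra R) (alpha : M -> M)
    (alpha_hom : star_hom alpha) (alpha_normal : normal alpha) :
  (exists L : lifting alpha, asymptotic_lift L) /\
  (forall L1 L2 : lifting alpha,
     asymptotic_lift L1 -> asymptotic_lift L2 -> isomorphic_liftings L1 L2).
Proof.
split; first exact: asymptotic_lift_exists.
by move=> L1 L2; exact: asymptotic_lift_unique.
Qed.
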